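(* Let $\mathbf{M}_1$ be the set of isomorphism classes $[\mathscr{M}]$ of normalized bounded Lorentzian metric measure spaces $\mathscr{M}$. Then the quantity $\mathsf{L}\square([\mathscr{M}],[\mathscr{M}']):=\mathsf{L}\square(\mathscr{M},\mathscr{M}')$, where $\mathsf{L}\square$ is the Lorentz--Gromov box distance, is a well-defined metric on $\mathbf{M}_1$ (in particular, it is independent of the chosen representatives).
   Context: A bounded Lorentzian metric space is a pair $(\mathsf{M},\tau)$ of a nonempty set $\mathsf{M}$ and a function $\tau\colon\mathsf{M}^2\to[0,\infty)$ such that: (a) $\tau(x,y)+\tau(y,z)\le\tau(x,z)$ whenever $\tau(x,y)>0$ and $\tau(y,z)>0$; (b) there is a topology $T$ on $\mathsf{M}$ such that $\tau$ is continuous for the product topology $T^2$ and $\{\tau\ge\varepsilon\}\subset\mathsf{M}^2$ is compact for every $\varepsilon>0$; (c) for all distinct $x,y\in\mathsf{M}$ there is $z\in\mathsf{M}$ with $\tau(x,z)\ne\tau(y,z)$ or $\tau(z,x)\neq\tau(z,y)$. All topological and Borel notions on $\mathsf{M}$ refer to the coarsest topology satisfying (b), which exists and is Polish. A normalized bounded Lorentzian metric measure space is a triple $\mathscr{M}=(\mathsf{M},\tau,\mathfrak{m})$ with $(\mathsf{M},\tau)$ a bounded Lorentzian metric space and $\mathfrak{m}$ a Borel probability measure on $\mathsf{M}$ (not necessarily of full support). Isomorphy. The spacelike boundary $i^0$ of a bounded Lorentzian metric space is the (unique, if it exists) point with $\tau(i^0,x)=\tau(x,i^0)=0$ for every $x$.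 On $\mathrm{spt}\,\mathfrak{m}$ define $x\sim y$ if $\tau(x,z)=\tau(y,z)$ and $\tau(z,x)=\tau(z,y)$ for every $z\in\mathrm{spt}\,\mathfrak{m}$. Let $q\colon\mathrm{spt}\,\mathfrak{m}\to\tilde{\mathsf{M}}$ be the quotient projection and $\tilde\tau(q(x),q(y)):=\tau(x,y)$; then $(\tilde{\mathsf{M}},\tilde\tau)$ is a bounded Lorentzian metric space, and $\mathrm{spt}\,q_\sharp\mathfrak{m}=\tilde{\mathsf{M}}$, where $\sharp$ denotes push-forward. Write $\mathrm{spt}\,q_\sharp\mathfrak{m}\cup\{i^0\}$ for this space itself if it already has a spacelike boundary, and otherwise for the bounded Lorentzian metric space obtained by adjoining an abstract point $i^0$ and extending $\tilde\tau$ by zero to pairs involving $i^0$. Use primes for the analogous objects of $\mathscr{M}'$. $\mathscr{M}$ and $\mathscr{M}'$ are isomorphic if there is a Borel measurable map $\iota\colon\mathrm{spt}\,q_\sharp\mathfrak{m}\cup\{i^0\}\to\mathrm{spt}\,q'_\sharp\mathfrak{m}'\cup\{i'^0\}$ with $\tilde\tau(x,y)=\tilde\tau'(\iota(x),\iota(y))$ for all $x,y$ and $\iota_\sharp(q_\sharp\mathfrak{m})=q'_\sharp\mathfrak{m}'$. This is an equivalence relation. Box distance. For Borel measurable $u,v\colon[0,1]^2\to[0,\infty)$ let $\square(u,v)$ be the infimum of all $\varepsilon>0$ for which there is a Borel set $Q\subset[0,1]$ with $\mathscr{L}^1[Q]\le\varepsilon$ and $|u-v|\le\varepsilon$ on $([0,1]\setminus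 Q)^2$, where $\mathscr{L}^1$ is Lebesgue measure. $\mathrm{Par}\,\mathscr{M}$ is the (nonempty) set of parametrizations of $\mathscr{M}$, i.e. Borel maps $\psi\colon[0,1]\to\mathsf{M}$ with $\psi_\sharp\mathscr{L}^1=\mathfrak{m}$; $\psi^*\tau(s,t):=\tau(\psi(s),\psi(t))$. Then $\mathsf{L}\square(\mathscr{M},\mathscr{M}'):=\inf\{\square(\psi^*\tau,\psi'^*\tau'):\psi\in\mathrm{Par}\,\mathscr{M},\ \psi'\in\mathrm{Par}\,\mathscr{M}'\}$. *)

(* Defs.v *)
From HB Require Import structures.
From mathcomp Require Import all_boot all_order all_algebra.
From mathcomp Require Import all_classical all_reals all_analysis.
Import Order.TTheory GRing.Theory Num.Theory numFieldNormedType.Exports.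

Set Implicit Arguments.
Unset Strict Implicit.
Unset Printing Implicit Defensive.

Local Open Scope classical_set_scope.
Local Open Scope quotient_scope.
Local Open Scope ring_scope.

(* Condition (b) quantifies over topologies on a fixed set, so topologies are
   values here; [topologized] turns such a value into a topologicalType. *)
Record topology (T : Type) := Topology {
  opens : set_system T ;
  opensT : opens setT ;
  opensI : setI_closed opens ;
  opens_bigU : forall F : set_system T, F `<=` opens ->
    opens (\bigcup_(A in F) A) }.

Definition topologized (T : choiceType) (O : topology T) : Type := T.

Section topologized.
Variables (T : choiceType) (O : topology T).

Lemma opens_bigcup (I : Type) (f : I -> set T) :
  (forall i, opens O (f i)) -> opens O (\bigcup_i f i).
Proof.
move=> Of; have -> : \bigcup_i f i = \bigcup_(A in range f) A.
  by rewrite bigcup_image.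
by apply: opens_bigU => _ [i _ <-].
Qed.

HB.instance Definition _ := Choice.on (topologized O).
HB.instance Definition _ := @isOpenTopological.Build (topologized O) (opens O)
  (opensT O) (@opensI _ O) opens_bigcup.

End topologized.

Section bounded_lorentzian.
Variables (R : realType) (T : choiceType) (tau : T -> T -> R).

Definition admissible (O : topology T) : Prop :=
  continuous (fun p : topologized O * topologized O => tau p.1 p.2) /\
  (forall e : R, 0 < e ->
    compact [set p : topologized O * topologized O | e <= tau p.1 p.2]).

(* The open sets of the coarsest admissible topology, as the intersection of
   all admissible ones: see [coarse_openE]. *)
Definition coarse_open : set_system T :=
  [set U | forall O, admissible O -> opens O U].

Lemma coarse_openE (O : topology T) :
  admissible O -> (forall O', admissible O' -> opens O `<=` opens O') ->
  coarse_open = opens O.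
Proof.
move=> Oa Omin; apply/seteqP; split=> U UO; first exact: UO.
by move=> O' /Omin; exact.
Qed.

Definition borel : set_system T := <<s coarse_open >>.

Definition bounded_lorentzian : Prop :=
  [/\ [set: T] !=set0,
      (forall x y, 0 <= tau x y),
      (forall x y z, 0 < tau x y -> 0 < tau y z ->
        tau x y + tau y z <= tau x z),
      (exists O, admissible O) &
      (forall x y, x <> y ->
        exists z, tau x z <> tau y z \/ tau z x <> tau z y)].

Definition spacelike_boundary (i : T) : Prop :=
  forall x, tau i x = 0 /\ tau x i = 0.

Definition adjoin_tau (a b : option T) : R :=
  if (a, b) is (Some x, Some y) then tau x y else 0.

Record tau_extension := TauExtension {
  ext_car :> choiceType ;
  ext_tau : ext_car -> ext_car -> R ;
  ext_in : T -> ext_car }.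

Definition with_i0 : tau_extension :=
  if pselect (exists i, spacelike_boundary i) then TauExtension tau id
  else TauExtension adjoin_tau Some.

End bounded_lorentzian.

(* Normalized bounded Lorentzian metric measure spaces.  The base point of the
   carrier only serves the library's measurable types; nothing below uses it. *)
Record nblmms (R : realType) := Nblmms {
  mm_car :> pointedType ;
  mm_tau : mm_car -> mm_car -> R ;
  mm_lorentzian : bounded_lorentzian mm_tau ;
  mm_measure : probability (g_sigma_algebraType (coarse_open mm_tau)) R }.

Section isomorphy.
Variables (R : realType) (X : nblmms R).

Definition spt : set X :=
  [set x | forall U, coarse_open (@mm_tau R X) U -> U x ->
    (0 < mm_measure X U)%E].

Definition spt_sim (x y : spt) : bool :=
  `[< forall z : spt,
        mm_tau (val x) (val z) = mm_tau (val y) (val z) /\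
        mm_tau (val z) (val x) = mm_tau (val z) (val y) >].

Lemma spt_sim_equiv : equiv_class_of spt_sim.
Proof.
split=> [x|x y|y x z].
- exact/asboolP.
- by apply/asboolP/asboolP => + z => /(_ z) [-> ->].
- move=> /asboolP xy /asboolP yz; apply/asboolP => w.
  by have [-> ->] := xy w; have [-> ->] := yz w.
Qed.

Canonical spt_sim_equivRel := EquivRelPack spt_sim_equiv.

Definition spt_quot : choiceType := {eq_quot spt_sim_equivRel}.

Definition spt_q (x : spt) : spt_quot := \pi_({eq_quot spt_sim_equivRel}) x.

Definition spt_tau (a b : spt_quot) : R :=
  mm_tau (val (repr a)) (val (repr b)).

Lemma spt_tauE (x y : spt) :
  spt_tau (spt_q x) (spt_q y) = mm_tau (val x) (val y).
Proof.
rewrite /spt_tau; have simP (z : spt) : spt_sim (repr (spt_q z)) z.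
  by apply/(@eqmodP _ spt_sim_equivRel); rewrite reprK.
have /asboolP/(_ (repr (spt_q y)))[-> _] := simP x.
by have /asboolP/(_ x)[_ ->] := simP y.
Qed.

(* Push-forward of the measure under [spt_q], which is defined on the support
   only: [val @` (spt_q @^-1` B)] is the preimage of B as a subset of X. *)
Definition spt_push (B : set spt_quot) : \bar R :=
  mm_measure X (val @` (spt_q @^-1` B)).

Definition spt_i0 : tau_extension R spt_quot := with_i0 spt_tau.

Definition spt_i0_push (B : set spt_i0) : \bar R :=
  spt_push (@ext_in _ _ spt_i0 @^-1` B).

End isomorphy.

Definition isomorphic (R : realType) (X X' : nblmms R) : Prop :=
  exists iota : spt_i0 X -> spt_i0 X',
    [/\ (forall B, borel (@ext_tau _ _ (spt_i0 X')) B ->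
          borel (@ext_tau _ _ (spt_i0 X)) (iota @^-1` B)),
        (forall x y, ext_tau x y = ext_tau (iota x) (iota y)) &
        (forall B, borel (@ext_tau _ _ (spt_i0 X')) B ->
          spt_i0_push (iota @^-1` B) = spt_i0_push B)].

(* Functions on [0,1] and [0,1]^2 are represented by functions on R and R^2 of
   which only the values on `[0, 1] matter. *)
Section box.
Variable R : realType.

Definition box (u v : R -> R -> R) : R :=
  inf [set e : R | 0 < e /\
    exists Q : set (measurableTypeR R),
      [/\ measurable Q, Q `<=` `[0, 1],
          (lebesgue_measure Q <= e%:E)%E &
          forall s t : R, (`[0, 1] `\` Q) s -> (`[0, 1] `\` Q) t ->
            `|u s t - v s t| <= e]].

Definition parametrization (X : nblmms R)
    (psi : measurableTypeR R -> g_sigma_algebraType (coarse_open (@mm_tau R X)))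
    : Prop :=
  measurable_fun (`[0, 1] : set (measurableTypeR R)) psi /\
  forall B, measurable B ->
    lebesgue_measure (`[0, 1] `&` psi @^-1` B) = mm_measure X B.

Definition lorentz_box (X X' : nblmms R) : R :=
  inf [set r : R | exists psi psi',
    [/\ parametrization (X := X) psi, parametrization (X := X') psi' &
        r = box (fun s t => mm_tau (psi s : X) (psi t : X))
                (fun s t => mm_tau (psi' s : X') (psi' t : X'))]].

Definition iso_classes : Type :=
  {C : nblmms R -> Prop | exists X, C = isomorphic X}.

Definition iso_class (X : nblmms R) : iso_classes :=
  exist _ (isomorphic X) (ex_intro _ X erefl).

Definition is_metric (S : Type) (d : S -> S -> R) : Prop :=
  [/\ (forall x y, 0 <= d x y),
      (forall x y, d x y = 0 <-> x = y),
      (forall x y, d x y = d y x) &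
      (forall x y z, d x z <= d x y + d y z)].

End box.

(* Main.v *)
(* The coarsest admissible topology is metrized by the distinction distance
   sup_z max(|tau x z - tau y z|, |tau z x - tau z y|), for which tau is Lipschitz
   and the space is totally bounded; with a spacelike boundary it is compact.

   Triangle inequality: two parametrizations of the same space can be rearranged
   by measure-preserving maps of [0,1] so that both visit a given finite Borel
   partition in the same order; the partition being fine, the two pull-backs of
   tau are then uniformly close. The same matching, applied to spt/~ with its
   spacelike boundary, shows that isomorphic spaces have box distance zero.

   Conversely, if the box distance vanishes, parametrizations theta_n, theta'_n
   with box distance tending to zero are approximate isometries
   theta_n(t) |-> theta'_n(t) between two compact spaces. Their limit along an
   ultrafilter on the integers is a tau-preserving map, and it preserves the
   measures because theta'_n is uniformly close to its composition with theta_n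
   off small sets. Hence isomorphy is the relation "box distance zero", and it is
   an equivalence relation because the box distance is a pseudometric. *)
Require Import Defs.
From HB Require Import structures.
From mathcomp Require Import all_boot all_order all_algebra.
From mathcomp Require Import all_classical all_reals all_analysis.
From mathcomp Require Import measurable_realfun lra.
Import Order.TTheory GRing.Theory Num.Theory numFieldNormedType.Exports.

Set Implicit Arguments.
Unset Strict Implicit.
Unset Printing Implicit Defensive.

Local Open Scope classical_set_scope.
Local Open Scope ring_scope.

(** * The distinction distance *)

Lemma ultra_fmap (T U : Type) (f : T -> U) (F : set_system T) :
  UltraFilter F -> UltraFilter (f @ F).
Proof.
move=> FU; split; first exact: fmap_proper_filter.
move=> G GF fFG; apply/seteqP; split=> // A GA.
have [//|FnA] := in_ultra_setVsetC (f @^-1` A) FU.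
have GnA : G (~` A) by exact: fFG.
by have [? []] := filter_ex (filterI GA GnA).
Qed.

Lemma near_natSinv_le (R : realType) (e : R) : 0 < e ->
  \forall n \near \oo, n.+1%:R^-1 <= e.
Proof.
move=> e0; have [n _ ne] := near_infty_natSinv_lt (PosNum e0).
by exists n => // m /ne/ltW.
Qed.

Section tclose.
Context {R : realType} {T : Type} (tau : T -> T -> R).

(* [tclose e x y] says that the distinction distance
   sup_z max(|tau x z - tau y z|, |tau z x - tau z y|) is at most e. *)
Definition tclose (e : R) (x y : T) : Prop :=
  forall z, `|tau x z - tau y z| <= e /\ `|tau z x - tau z y| <= e.

Lemma tclosexx e x : 0 <= e -> tclose e x x.
Proof. by move=> e0 z; rewrite !subrr normr0. Qed.

Lemma tclose_sym e x y : tclose e x y -> tclose e y x.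
Proof. by move=> xy z; have [] := xy z; split; rewrite distrC. Qed.

Lemma tclose_trans y e d x z : tclose e x y -> tclose d y z -> tclose (e + d) x z.
Proof.
move=> xy yz w; have [xy1 xy2] := xy w; have [yz1 yz2] := yz w.
split; first by apply: le_trans (ler_distD (tau y w) _ _) _; exact: lerD.
by apply: le_trans (ler_distD (tau w y) _ _) _; exact: lerD.
Qed.

Lemma tclose_le e d x y : e <= d -> tclose e x y -> tclose d x y.
Proof. by move=> ed xy z; have [xy1 xy2] := xy z; split; exact: le_trans ed. Qed.

Lemma tclose_tau e d x x' y y' : tclose e x x' -> tclose d y y' ->
  `|tau x y - tau x' y'| <= e + d.
Proof.
move=> /(_ y)[xx' _] /(_ x')[_ yy'].
by apply: le_trans (ler_distD (tau x' y) _ _) _; exact: lerD.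
Qed.

Lemma tclose_lim e x y : (forall d, 0 < d -> tclose (e + d) x y) -> tclose e x y.
Proof.
by move=> xy z; split; apply/ler_addgt0Pr => d d0; have [] := xy d d0 z.
Qed.

Definition tclose_open (U : set T) : Prop :=
  forall x, U x -> exists2 e, 0 < e & tclose e x `<=` U.

Definition tclose_closed (F : set T) : Prop := tclose_open (~` F).

Definition tclose_lim_of (F : set_system T) (x : T) : Prop :=
  forall e, 0 < e -> F (tclose e x).

Lemma tclose_ball_closed e x : tclose_closed (tclose e x).
Proof.
move=> y nxy; apply: contrapT => n; apply: nxy; apply: tclose_lim => d d0.
apply: contrapT => n'; apply: n; exists d => // z yz xz; apply: n'.
exact: tclose_trans xz (tclose_sym yz).
Qed.

(** The points whose distance to [F], an infimum that need not be attained, is at most [e]. The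
    slack [d] is what makes this set closed for every [F]. *)
Definition enlarge (F : set T) (e : R) : set T :=
  [set y | forall d, 0 < d -> exists2 x, F x & tclose (e + d) x y].

Lemma enlarge_closed F e : tclose_closed (enlarge F e).
Proof.
move=> y nFy; apply: contrapT => n; apply: nFy => d d0.
have d20 : 0 < d / 2 by rewrite divr_gt0.
apply: contrapT => n'; apply: n; exists (d / 2) => // z yz Fz.
have [x Fx xz] := Fz _ d20; apply: n'; exists x => //.
apply: tclose_le (tclose_trans xz (tclose_sym yz)); lra.
Qed.

Lemma bigcap_enlarge F (u : nat -> R) : tclose_closed F ->
  (forall e, 0 < e -> exists n, u n <= e) -> \bigcap_n enlarge F (u n) `<=` F.
Proof.
move=> cF u0 y Fy; apply: contrapT => nFy; have [e e0 ey] := cF _ nFy.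
have [n un] := u0 (e / 2) (divr_gt0 e0 (ltr0n _ 2)).
have [x Fx xy] := Fy n I (e / 2) (divr_gt0 e0 (ltr0n _ 2)).
apply: ey Fx; apply: tclose_sym; apply: tclose_le xy; lra.
Qed.

Lemma sub_enlarge F e : 0 <= e -> F `<=` enlarge F e.
Proof. by move=> e0 x Fx d d0; exists x => //; apply: tclosexx; lra. Qed.

End tclose.

(** * The topology of the distinction distance *)

Section tclose_topology.
Context {R : realType} {T : choiceType} (tau : T -> T -> R).

Let tclose_openT : tclose_open tau setT.
Proof. by move=> x _; exists 1. Qed.

Let tclose_openI : setI_closed (tclose_open tau).
Proof.
move=> A B oA oB x [/oA[e e0 Ae] /oB[d d0 Bd]].
exists (Num.min e d); first by rewrite lt_min e0.
move=> y xy; split.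
  by apply/Ae/(tclose_le _ xy); rewrite ge_min lexx.
by apply/Bd/(tclose_le _ xy); rewrite ge_min lexx orbT.
Qed.

Let tclose_open_bigU (F : set_system T) : F `<=` tclose_open tau ->
  tclose_open tau (\bigcup_(A in F) A).
Proof.
move=> oF x [A FA /(oF _ FA)[e e0 Ae]].
by exists e => // y /Ae Ay; exists A.
Qed.

Definition tclose_topology : topology T :=
  Topology tclose_openT tclose_openI tclose_open_bigU.

Lemma tclose_interior_open (A : set T) :
  tclose_open tau [set y | exists2 d, 0 < d & tclose tau d y `<=` A].
Proof.
move=> y [d d0 dy]; have d20 : 0 < d / 2 by rewrite divr_gt0.
exists (d / 2) => // z yz; exists (d / 2) => // w zw; apply: dy.
by rewrite [d]splitr; exact: tclose_trans yz zw.
Qed.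

Lemma tclose_nbhsP (x : T) (A : set T) :
  nbhs (x : topologized tclose_topology) A <->
  exists2 e, 0 < e & tclose tau e x `<=` A.
Proof.
split.
  rewrite nbhsE => -[B [oB Bx] BA].
  by have [e e0 Be] := oB _ Bx; exists e => // y /Be/BA.
move=> [e e0 eA].
rewrite nbhsE; exists [set y | exists2 d, 0 < d & tclose tau d y `<=` tclose tau e x].
  by split; [exact: tclose_interior_open|exists e].
move=> y [d d0 dy]; apply/eA/dy/tclosexx; lra.
Qed.

(** Continuity is automatic, since [tau] is 1-Lipschitz in each variable. The hypothesis is
    compactness of the superlevel sets in terms of ultrafilters; the limit need not be assumed to
    lie in the superlevel set, as this follows from continuity. *)
Lemma tclose_topology_admissible :
  (forall (e : R) (F : set_system (T * T)), 0 < e -> UltraFilter F ->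
     F [set p | e <= tau p.1 p.2] ->
     exists x y, forall d, 0 < d ->
       F [set p | tclose tau d x p.1 /\ tclose tau d y p.2]) ->
  admissible tau tclose_topology.
Proof.
move=> tauF; split.
  move=> [x y]; apply/cvgrPdist_le => e e0 /=.
  have e20 : 0 < e / 2 by rewrite divr_gt0.
  exists (tclose tau (e / 2) x, tclose tau (e / 2) y) => /=.
    by split; apply/tclose_nbhsP; exists (e / 2).
  move=> [x' y'] [/= xx' yy']; apply: le_trans (tclose_tau xx' yy') _; lra.
move=> e e0; rewrite compact_ultra => F FU Fe.
have [x [y Fxy]] := tauF e F e0 FU Fe.
exists (x, y); split => /=.
  apply/ler_addgt0Pl => d d0; have d20 : 0 < d / 2 by rewrite divr_gt0.
  have [[x' y'] [/= xy' [xx' yy']]] := filter_ex (filterI Fe (Fxy _ d20)).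
  have := tclose_tau xx' yy'; rewrite ler_distl => /andP[]; lra.
move=> A [[A1 A2]] /= [/tclose_nbhsP[e1 e10 eA1] /tclose_nbhsP[e2 e20 eA2]] A12.
have e12 : 0 < Num.min e1 e2 by rewrite lt_min e10.
apply: filterS (Fxy _ e12) => -[x' y'] [/= xx' yy']; apply: A12; split => /=.
  by apply/eA1/(tclose_le _ xx'); rewrite ge_min lexx.
by apply/eA2/(tclose_le _ yy'); rewrite ge_min lexx orbT.
Qed.

(* Only z in the compact projections of {e <= tau} matter: elsewhere both
   values lie in [0, e]. *)
Lemma admissible_near_close (O : topology T) : (forall x y, 0 <= tau x y) ->
  admissible tau O -> forall (x : T) (e : R), 0 < e ->
  nbhs (x : topologized O) (tclose tau e x).
Proof.
move=> tau0 [ctau Ktau] x e e0.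
have e20 : 0 < e / 2 by rewrite divr_gt0.
have bnd (a b : R) : 0 <= a -> 0 <= b -> ~ e <= a -> ~ e <= b -> `|a - b| <= e.
  move=> a0 b0 /negP + /negP; rewrite -!ltNge => ae be.
  by rewrite ler_distl; apply/andP; split; lra.
pose K := [set p : topologized O * topologized O | e <= tau p.1 p.2].
have K1 : compact (fst @` K).
  apply: continuous_compact; last exact: Ktau.
  by apply: continuous_subspaceT => p; exact: cvg_fst.
have K2 : compact (snd @` K).
  apply: continuous_compact; last exact: Ktau.
  by apply: continuous_subspaceT => p; exact: cvg_snd.
(* A tube lemma: joint continuity at (x, z) compares both values with [tau x z] up to e/2, and
   compactness makes the neighbourhood of [x] uniform in z. *)
have N1 : \forall y \near (x : topologized O),
    (snd @` K `|` fst @` K) `<=` (fun z => `|tau x z - tau y z| <= e).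
  have /compact_near_coveringP cov := compactU K2 K1.
  apply: (cov _ (nbhs (x : topologized O))
    (fun y z => `|tau x z - tau y z| <= e)) => z _.
  have /cvgrPdist_le /(_ _ e20) := ctau (x, z).
  case=> -[U V] /= [Ux Vz] UV.
  exists (V, U) => // -[z' x'] /= [Vz' Ux'].
  have xz' : (U `*` V) (x, z') by split => //=; exact: nbhs_singleton Ux.
  have /= h1 := UV _ xz'.
  have /= h2 := UV (x', z') (conj Ux' Vz').
  by move: h1 h2; rewrite !ler_distl => /andP[? ?] /andP[? ?];
    apply/andP; split; lra.
have N2 : \forall y \near (x : topologized O),
    (snd @` K `|` fst @` K) `<=` (fun z => `|tau z x - tau z y| <= e).
  have /compact_near_coveringP cov := compactU K2 K1.
  apply: (cov _ (nbhs (x : topologized O))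
    (fun y z => `|tau z x - tau z y| <= e)) => z _.
  have /cvgrPdist_le /(_ _ e20) := ctau (z, x).
  case=> -[V U] /= [Vz Ux] UV.
  exists (V, U) => // -[z' x'] /= [Vz' Ux'].
  have xz' : (V `*` U) (z', x) by split => //=; exact: nbhs_singleton Ux.
  have /= h1 := UV _ xz'.
  have /= h2 := UV (z', x') (conj Vz' Ux').
  by move: h1 h2; rewrite !ler_distl => /andP[? ?] /andP[? ?];
    apply/andP; split; lra.
near=> y => z; split.
- have [Kz|nKz] := pselect ((snd @` K `|` fst @` K) z).
    by apply: (near N1 y).
  apply: bnd => // h; apply: nKz; left; [by exists (x, z)|by exists (y, z)].
- have [Kz|nKz] := pselect ((snd @` K `|` fst @` K) z).
    by apply: (near N2 y).
  apply: bnd => // h; apply: nKz; right; [by exists (z, x)|by exists (z, y)].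
Unshelve. all: by end_near. Qed.

End tclose_topology.

(** * Compactness properties of bounded Lorentzian metric spaces *)

Section bounded_lorentzian_theory.
Context {R : realType} {T : choiceType} (tau : T -> T -> R).
Hypothesis tauL : bounded_lorentzian tau.

Lemma lorentzian_ge0 x y : 0 <= tau x y.
Proof. by have [_ + _ _ _] := tauL; apply. Qed.

Lemma tclose_eq x y : (forall e, 0 < e -> tclose tau e x y) -> x = y.
Proof.
move=> xy; apply: contrapT => nxy.
have [_ _ _ _ /(_ x y nxy)[z]] := tauL.
have xyz : tclose tau 0 x y by apply: tclose_lim => e e0; rewrite add0r; exact: xy.
by have [] := xyz z; rewrite !normr_le0 !subr_eq0 => /eqP -> /eqP -> [].
Qed.

(** An ultrafilter limit exists in some admissible topology, and it is also a limit for the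
    distinction distance because balls are neighbourhoods there. *)
Lemma lorentzian_ultra (e : R) (F : set_system (T * T)) : 0 < e ->
  UltraFilter F -> F [set p | e <= tau p.1 p.2] ->
  exists x y, forall d, 0 < d ->
    F [set p | tclose tau d x p.1 /\ tclose tau d y p.2].
Proof.
move=> e0 FU Fe; have [_ _ _ [Ot Oa] _] := tauL.
have [_ /(_ _ e0)] := Oa; rewrite compact_ultra => /(_ F FU Fe)[[x y] [_ Fxy]].
exists x, y => d d0; apply: Fxy.
by exists (tclose tau d x, tclose tau d y) => //; split;
  apply: admissible_near_close => //; exact: lorentzian_ge0.
Qed.

(** The topology of the distinction distance is admissible, and it is coarser than any admissible
    one because balls are neighbourhoods in the latter. *)
Lemma coarse_open_close : coarse_open tau = tclose_open tau.
Proof.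
rewrite (@coarse_openE _ _ _ (tclose_topology tau))//.
  exact/tclose_topology_admissible/lorentzian_ultra.
move=> O Oa U oU.
suff : @open (topologized O) U by [].
rewrite openE => x /oU[e e0 eU]; apply: filterS eU _.
by apply: admissible_near_close => //; exact: lorentzian_ge0.
Qed.

Lemma borel_open U : tclose_open tau U -> borel tau U.
Proof. by move=> oU; apply: sub_sigma_algebra; rewrite coarse_open_close. Qed.

Lemma borel_closed F : tclose_closed tau F -> borel tau F.
Proof.
by move=> /borel_open/(@sigma_algebraCD _ _ _ _); rewrite setTD setCK.
Qed.

(** The union of the two projections of {e <= tau}: the part of the space controlled by compactness.
    Its complement has small distinction diameter. *)
Definition related (e : R) (x : T) : Prop :=
  exists z, e <= tau x z \/ e <= tau z x.

(** Choosing a partner [f x] for each related [x] lifts the ultrafilter to pairs in {e <= tau},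
    where limits exist; one of the two orders of the pair occurs along the whole ultrafilter. *)
Lemma related_ultra e : 0 < e ->
  forall F : set_system T, UltraFilter F -> F (related e) ->
  exists x, tclose_lim_of tau F x.
Proof.
move=> e0 F FU Fe; have [x0 _] := filter_ex Fe.
have [f fP] : exists f : T -> T,
    forall x, related e x -> e <= tau x (f x) \/ e <= tau (f x) x.
  have ex (x : T) : exists z, related e x -> e <= tau x z \/ e <= tau z x.
    by have [[z xz]|n] := pselect (related e x); [exists z|exists x].
  by have [f fP] := choice ex; exists f.
have [Fr|nFr] := in_ultra_setVsetC [set x | e <= tau x (f x)] FU.
  have := lorentzian_ultra e0 (ultra_fmap (fun x => (x, f x)) FU) Fr.
  move=> [x [y xy]]; exists x => d d0.
  have : F [set z | tclose tau d x z /\ tclose tau d y (f z)] by exact: xy.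
  by apply: filterS => z [].
have Fr : F [set x | e <= tau (f x) x].
  by apply: filterS (filterI Fe nFr) => x [/fP + nx]; case=> // /nx.
have := lorentzian_ultra e0 (ultra_fmap (fun x => (f x, x)) FU) Fr.
move=> [x [y xy]]; exists y => d d0.
have : F [set z | tclose tau d x (f z) /\ tclose tau d y z] by exact: xy.
by apply: filterS => z [].
Qed.

Lemma not_related_close e x y : ~ related e x -> ~ related e y ->
  tclose tau e x y.
Proof.
move=> /forallNP nx /forallNP ny z.
have := nx z; have := ny z.
move=> /not_orP[/negP + /negP +] /not_orP[/negP + /negP]; rewrite -!ltNge.
have := lorentzian_ge0 x z; have := lorentzian_ge0 z x.
have := lorentzian_ge0 y z; have := lorentzian_ge0 z y.
by move=> *; split; rewrite ler_distl; apply/andP; split; lra.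
Qed.

Lemma boundary_not_related e i : 0 < e -> spacelike_boundary tau i ->
  ~ related e i.
Proof. by move=> e0 iP [z]; have [-> ->] := iP z; rewrite leNgt e0 => -[]. Qed.

(** Compactness in the presence of a spacelike boundary: an ultrafilter that contains no set
    [related e] converges to the boundary point. *)
Lemma boundary_ultra (i : T) (F : set_system T) : spacelike_boundary tau i ->
  UltraFilter F -> exists x, tclose_lim_of tau F x.
Proof.
move=> iP FU.
have [[e [e0 Fe]]|n] := pselect (exists e, 0 < e /\ F (related e)).
  exact: related_ultra Fe.
exists i => e e0; have [Fe|] := in_ultra_setVsetC (related e) FU.
  by exfalso; apply: n; exists e.
by apply: filterS => x; apply: not_related_close; exact: boundary_not_related.
Qed.

(** Without a finite net, the sets of points far from finitely many centres generate a proper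
    filter. An ultrafilter above it contains no ball of radius [e], yet it either converges or
    contains the mutually close unrelated points. *)
Lemma totally_bounded e : 0 < e ->
  exists s : seq T, forall x, exists2 p, p \in s & tclose tau e p x.
Proof.
move=> e0; apply: contrapT => /forallNP n.
pose B (s : seq T) : set T := [set x | forall p, p \in s -> ~ tclose tau e p x].
have FF : ProperFilter (filter_from setT B).
  apply: filter_from_proper; last first.
    move=> s _; have /existsNP[x nx] := n s; exists x => p ps px.
    by apply: nx; exists p.
  apply: filter_from_filter; first by exists [::].
  move=> s t _ _; exists (s ++ t) => // x Bx.
  by split=> p ps; apply: Bx; rewrite mem_cat ps ?orbT.
have [G [GU FG]] := ultraFilterLemma FF.
have Gn p : G (~` tclose tau e p).
  by apply: FG; exists [:: p] => // x; apply; rewrite mem_head.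
suff [x xG] : exists x, G (tclose tau e x).
  by have [? []] := filter_ex (filterI xG (Gn x)).
have [Ge|Gne] := in_ultra_setVsetC (related e) GU.
  by have [x Gx] := related_ultra e0 GU Ge; exists x; exact: Gx.
have [x nx] := filter_ex Gne; exists x; apply: filterS Gne => y.
exact: not_related_close.
Qed.

(** The finite nets of radii 1/(n+1), enumerated together through codes of pairs. *)
Lemma dense_sequence : exists p : nat -> T, forall (e : R), 0 < e ->
  forall x, exists k, tclose tau e (p k) x.
Proof.
have [[x0 _] _ _ _ _] := tauL.
have [s sP] := @choice _ _ _
  (fun n : nat => totally_bounded (ltac:(by []) : 0 < n.+1%:R^-1 :> R)).
exists (fun k => if unpickle k is Some (n, j) then nth x0 (s n) j else x0).
move=> e e0 x; have [n ne] : exists n, n.+1%:R^-1 <= e.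
  by have [n _ /(_ _ (leqnn n))] := near_natSinv_le e0; exists n.
have [p ps px] := sP n x; exists (pickle (n, index p (s n))).
rewrite pickleK nth_index//; exact: tclose_le ne px.
Qed.

End bounded_lorentzian_theory.

(** * Quantiles and rearrangements of the unit interval *)

Section uniform01.
Context {R : realType}.
Local Notation RM := (measurableTypeR R).
Local Notation leb := (@lebesgue_measure R).

(** Lebesgue measure on [0,1] as a probability on the whole line, so that rearrangements can be
    total maps of R. *)
Definition unif01 : set RM -> \bar R :=
  mrestr leb (measurable_itv `[0, 1] : measurable (`[0, 1]%classic : set RM)).

HB.instance Definition _ := Measure.on unif01.

Let unif01_setT : unif01 setT = 1%:E.
Proof. by rewrite /unif01 /mrestr setTI lebesgue_measure_itv/= lte01 oppr0 adde0. Qed.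

HB.instance Definition _ :=
  @Measure_isProbability.Build _ _ _ unif01 unif01_setT.

Lemma unif01E (A : set RM) : unif01 A = leb (`[0, 1] `&` A).
Proof. by rewrite /unif01 /mrestr setIC. Qed.

Lemma unif01_itvoo (A : set RM) : measurable A ->
  unif01 A = leb (`]0, 1[ `&` A).
Proof.
move=> mA; rewrite unif01E; apply/eqP; rewrite eq_le; apply/andP; split.
  have -> : leb (`]0, 1[ `&` A) =
      (leb (`]0%R, 1%R[ `&` A) + leb ([set 0%R] `|` [set 1%R]))%E.
    rewrite [X in (_ + X)%E](_ : _ = 0%E) ?adde0//.
    apply/countable_lebesgue_measure0/finite_set_countable.
    by rewrite finite_setU.
  apply: le_trans (measureU2 _ _ _) => //; [|exact: measurableI|exact: measurableU].
  apply: le_measure; rewrite ?inE; [exact: measurableI| |].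
    by apply: measurableU; [exact: measurableI|exact: measurableU].
  move=> x [/=]; rewrite !in_itv/= => /andP[x0 x1] Ax.
  have [->|x0'] := eqVneq x 0; first by right; left.
  have [->|x1'] := eqVneq x 1; first by right; right.
  by left; split => //; rewrite !lt_neqAle x0 x1 eq_sym x0' x1'.
apply: le_measure; rewrite ?inE; [exact: measurableI|exact: measurableI|].
by apply: setSI => x /=; rewrite !in_itv/= => /andP[/ltW -> /ltW ->].
Qed.

(** The generalized inverse of the distribution function. The first property is its Galois
    connection with that function, from which measurability and the law are read off. *)
Lemma quantile_exists (nu : probability RM R) :
  exists q : {mfun RM >-> RM},
    (forall u x : R, 0 < u < 1 -> ((q u : R) <= x) = (u%:E <= nu `]-oo, x]%classic)%E) /\
    (forall B, measurable B -> unif01 (q @^-1` B) = nu B).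
Proof.
pose X : RM -> R := idfun.
pose XM : {RV nu >-> R} := HB.pack X
  (isMeasurableFun.Build _ _ _ _ X (@measurable_id _ _ setT)).
pose F x := fine (nu `]-oo, x]%classic).
have FE x : nu `]-oo, x]%classic = (F x)%:E by rewrite /F fineK// fin_num_measure.
have cF x : cdf XM x = (F x)%:E by rewrite -FE.
have Fle x y : x <= y -> F x <= F y.
  by move=> xy; rewrite -lee_fin -!cF; exact: cdf_nondecreasing.
have F0 x : 0 <= F x by rewrite -lee_fin -FE.
have F1 x : F x <= 1 by rewrite -lee_fin -FE; exact: probability_le1.
pose S u := [set x | u <= F x].
(* Only for u in ]0, 1[ is [S u] certain to be nonempty and bounded below. *)
pose q (u : R) : R := if 0 < u < 1 then inf (S u) else 0.
have qP (u x : R) : 0 < u < 1 -> (q u <= x) = (u <= F x).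
  move=> /[dup] u01 /andP[u0 u1]; rewrite /q u01.
  have Sne : S u !=set0.
    have /fine_cvgP[_ /cvgrPdist_lt] := cvg_cdfy1 XM.
    have u10 : 0 < 1 - u by lra.
    move=> /(_ _ u10) [M [_ /(_ (M + 1))]]; rewrite ltrDl ltr01 => /(_ isT).
    rewrite /= cF /= ltr_distlC => /andP[h _]; exists (M + 1).
    by rewrite /S/=; apply: ltW; move: h; lra.
  have Slb : has_lbound (S u).
    have /fine_cvgP[_ /cvgrPdist_lt] := cvg_cdfNy0 XM.
    move=> /(_ _ u0) [M [_ hM]]; exists M => y uy.
    rewrite leNgt; apply/negP => /hM; rewrite /= cF/= sub0r normrN ger0_norm//.
    by rewrite ltNge (uy : u <= F y).
  apply/idP/idP; last by move=> ux; apply: ge_inf.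
  move=> infx; rewrite -lee_fin -cF.
  (* Right continuity puts the infimum itself into [S u]. *)
  have rc : cdf XM y @[y --> x^'+] --> cdf XM x by exact: cdf_right_continuous.
  have Fy y : x < y -> (u%:E <= cdf XM y)%E.
    move=> xy; rewrite cF lee_fin.
    have /(inf_lt Sne) [z Sz zy] : inf (S u) < y by exact: le_lt_trans xy.
    by apply: le_trans Sz (Fle _ _ (ltW zy)).
  apply: cvge_ge rc; near=> y; apply: Fy; near: y; exact: nbhs_right_gt.
have mq : measurable_fun setT (q : RM -> RM).
  apply: (measurability (@RGenOInfty.G R)) => [|/= _ [_] [x] -> <-].
    exact: RGenOInfty.measurableE.
  rewrite setTI.
  have -> : q @^-1` `]x, +oo[ =
      (`]0, 1[ `&` `]F x, +oo[) `|` (~` `]0, 1[ `&` [set _ | x < 0]).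
    apply/seteqP; split=> u /=; rewrite !in_itv/= !andbT.
      have [u01|nu01] := boolP (0 < u < 1).
        by rewrite ltNge qP// -ltNge; left.
      by rewrite /q (negPf nu01); right.
    case=> [[u01]|[/negP/negPf nu01]]; last by rewrite /q nu01.
    by rewrite [x < _]ltNge qP// -ltNge.
  apply: measurableU; first exact: measurableI.
  apply: measurableI; first exact: measurableC.
  by case: (x < 0); [rewrite (_ : [set _ | _] = setT)//; apply/seteqP; split
    |rewrite (_ : [set _ | _] = set0)//; apply/seteqP; split].
pose qm : {mfun RM >-> RM} := HB.pack (q : RM -> RM)
  (isMeasurableFun.Build _ _ _ _ (q : RM -> RM) mq).
exists qm; split=> [u x u01|B mB]; first by rewrite FE lee_fin; exact: qP.
rewrite -[LHS]/(distribution unif01 qm B).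
apply: (@measure_unique _ R RM (@RGenOInfty.G R) (fun n => `]- n%:R, +oo[%classic)
  _ _ _ _ (distribution unif01 qm) nu) => //.
- exact: RGenOInfty.measurableE.
- move=> _ _ [x ->] [y ->]; exists (Num.max x y).
  by apply/seteqP; split=> z /=; rewrite !in_itv/= !andbT gt_max; [case=> -> ->|move/andP].
- by move=> n; exists (- n%:R).
- apply/seteqP; split=> // x _; exists (Num.bound `|x|) => //=.
  rewrite in_itv/= andbT ltrNl (le_lt_trans _ (archi_boundP _))//.
  by rewrite -normrN ler_norm.
- move=> _ [x ->]; rewrite /distribution/= /pushforward/= unif01_itvoo; last first.
    by rewrite -[X in measurable X]setTI; exact: (mq).
  rewrite (_ : _ `&` _ = `]F x, 1[%classic); last first.
    apply/seteqP; split=> u /=; rewrite !in_itv/= !andbT.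
      by move=> [/[dup] u01 /andP[_ ->]]; rewrite ltNge qP// -ltNge andbT.
    move=> /andP[Fu u1]; have u01 : 0 < u < 1.
      by rewrite u1 andbT (le_lt_trans (F0 x)).
    by split => //; rewrite ltNge qP// -ltNge.
  rewrite lebesgue_measure_itv/= lte_fin -setCitvl probability_setC// FE.
  have := F1 x; rewrite le_eqVlt => /orP[/eqP->|->]; last by [].
  by rewrite ltxx subee.
- by move=> n; rewrite (le_lt_trans (probability_le1 _ _)) ?ltry//=.
Unshelve. all: by end_near. Qed.

End uniform01.

(** * Matching two partitions of the unit interval with equal masses *)

Section matching.
Context {R : realType}.
Local Notation RM := (measurableTypeR R).

Definition measure_preserving01 (a : RM -> RM) : Prop :=
  [/\ measurable_fun setT a, (forall s, (a s : R) \in `[0, 1]%R) &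
      forall B, measurable B -> unif01 (a @^-1` B) = unif01 B].

Lemma unif01_eq (A B : set RM) : `[0, 1]%classic `&` A = `[0, 1]%classic `&` B ->
  unif01 A = unif01 B.
Proof. by rewrite !unif01E => ->. Qed.

Lemma unif01_null_setU (A B : set RM) : measurable A -> measurable B ->
  unif01 A = 0%E -> unif01 B = 0%E -> unif01 (A `|` B) = 0%E.
Proof.
move=> mA mB A0 B0; apply/eqP; rewrite eq_le; apply/andP; split; last first.
  exact: measure_ge0.
apply: le_trans (measureU2 unif01 mA mB) _.
by have -> : (unif01 A + unif01 B = 0)%E by rewrite A0 B0 adde0.
Qed.

Let clip (s : RM) : RM := if (0 <= (s : R) <= 1) then s else 0.

Let clip01 s : 0 <= (clip s : R) <= 1.
Proof. by rewrite /clip; case: ifP => // _; rewrite lexx ler01. Qed.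

Let clipE s : 0 <= (s : R) <= 1 -> clip s = s.
Proof. by rewrite /clip => ->. Qed.

Let measurable_clip : measurable_fun setT clip.
Proof.
apply: measurable_fun_ifT; [|exact: measurable_id|exact: measurable_cst].
apply: (@measurable_fun_bool _ _ _ _ true); rewrite setTI.
by rewrite (_ : _ @^-1` _ = `[0, 1]%classic)//.
Qed.

Lemma measurable_natfun d (S : measurableType d) (k : S -> nat) :
  (forall n, measurable [set s | k s = n]) ->
  measurable_fun setT (fun s => (k s)%:R : RM).
Proof.
move=> mk _ B mB; rewrite setTI.
rewrite (_ : _ @^-1` _ = \bigcup_(n in [set n : nat | B n%:R]) [set s | k s = n]).
  exact: bigcup_measurable.
by apply/seteqP; split=> [s Bs|s [n /= Bn kn]]; [exists (k s)|rewrite /= kn].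
Qed.

Lemma measurable_natle d (S : measurableType d) (k : S -> nat) :
  (forall n, measurable [set s | k s = n]) ->
  forall n, measurable [set s | (k s <= n)%N].
Proof.
move=> mk n.
rewrite (_ : [set _ | _] = \bigcup_(m in [set m | (m <= n)%N]) [set s | k s = m]).
  exact: bigcup_measurable.
by apply/seteqP; split=> [s ks|s [m /= mn km]]; [exists (k s)|rewrite /= km].
Qed.

(* [a] is the quantile function of the law of [2 k s + s], followed by the map
   recovering [s] from [2 k s + s]; quantile functions being monotone, [k \o a]
   is nondecreasing and hence determined by the law of [k]. *)
Lemma nat_rearrangement (k : RM -> nat) :
  (forall n, measurable [set s | k s = n]) ->
  exists a, measure_preserving01 a /\
    exists N, [/\ measurable N, unif01 N = 0%E &
      forall s, ~ N s -> forall n, (k (a s) <= n)%N =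
        ((s : R)%:E <= unif01 [set s | (k s <= n)%N])%E].
Proof.
move=> mk.
pose h (s : RM) : RM := 2 * (k (clip s))%:R + (clip s : R).
have mh : measurable_fun setT h.
  apply: measurable_funD; last exact: measurable_clip.
  apply: measurable_funM; first exact: measurable_cst.
  exact: (measurableT_comp (measurable_natfun mk) measurable_clip).
pose hm : {mfun RM >-> RM} := HB.pack h (isMeasurableFun.Build _ _ _ _ h mh).
have [q [qP qlaw]] := quantile_exists (distribution unif01 hm).
pose t (r : RM) : RM := (Num.truncn ((r : R) / 2))%:R.
have mt : measurable_fun setT t.
  apply: nondecreasing_measurable => // x y xy; rewrite ler_nat.
  by apply: le_truncn; rewrite ler_pM2r.
pose g (r : RM) : RM := clip ((r : R) - 2 * (t r : R)).
have mg : measurable_fun setT g.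
  apply: (measurableT_comp measurable_clip).
  apply: measurable_funB; first exact: measurable_id.
  by apply: measurable_funM; [exact: measurable_cst|exact: mt].
(* The value [h s] lies in [2k, 2k+1]; the factor 2 leaves gaps between these intervals, so [k] can
   be recovered from [h s]. *)
have hle s n : ((h s : R) <= 2 * n%:R + 1) = (k (clip s) <= n)%N.
  have /andP[c0 c1] := clip01 s; rewrite /h; apply/idP/idP.
    rewrite -(ler_nat R); case: (leqP (k (clip s)) n) => [|nk].
      by rewrite ler_nat.
    have : n.+1%:R <= (k (clip s))%:R :> R by rewrite ler_nat.
    rewrite -natr1; move: c0 c1; set x := _%:R; set c := (clip s : R).
    by move=> *; exfalso; lra.
  by rewrite -(ler_nat R); lra.
have gh s : g (h s) = clip s.
  have /andP[c0 c1] := clip01 s; rewrite /g.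
  have -> : t (h s) = (k (clip s))%:R.
    rewrite /t; congr _%:R; apply: truncn_def; rewrite /h -[(k _).+1%:R]natr1.
    have k0 : 0 <= (k (clip s))%:R :> R by [].
    by apply/andP; split; lra.
  by rewrite /h addrC addKr clipE// ?clip01.
have mE n : measurable [set r : RM | ((r : R) <= 2 * n%:R + 1) = (k (g r) <= n)%N].
  have mA : measurable [set r : RM | ((r : R) <= 2 * n%:R + 1)].
    by rewrite (_ : [set _ | _] = `]-oo, 2 * n%:R + 1]%classic).
  have mB : measurable [set r : RM | (k (g r) <= n)%N].
    by have := mg measurableT _ (measurable_natle mk n); rewrite setTI.
  rewrite (_ : [set _ | _] = ([set r : RM | ((r : R) <= 2 * n%:R + 1)] `&`
       [set r : RM | (k (g r) <= n)%N]) `|`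
     (~` [set r : RM | ((r : R) <= 2 * n%:R + 1)] `&`
      ~` [set r : RM | (k (g r) <= n)%N])).
    by apply: measurableU; apply: measurableI => //; exact: measurableC.
  apply/seteqP; split=> r /=.
    by move=> ->; case: (_ <= n)%N; [left|right].
  by move=> [[-> ->]//|[/negP/negPf-> /negP/negPf->]].
(* [E] contains the range of [h], hence almost every value of [q], which has the law of [h]. *)
pose E := \bigcap_n [set r : RM | ((r : R) <= 2 * n%:R + 1) = (k (g r) <= n)%N].
have mE' : measurable E by exact: bigcapT_measurable.
have qm B : measurable B -> measurable (q @^-1` B).
  by move=> mB; rewrite -[X in measurable X]setTI; exact: measurable_funPT.
have mqE : measurable (q @^-1` (~` E)) by apply: qm; apply: measurableC.
exists (g \o q); split.
  split=> [||B mB].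
  - exact: (measurableT_comp mg).
  - by move=> s /=; rewrite in_itv/=; exact: clip01.
  - rewrite comp_preimage qlaw; last by rewrite -[X in measurable X]setTI; exact: mg.
    apply: unif01_eq; apply/seteqP; split=> s /= []; rewrite in_itv/= => s01;
      by rewrite gh clipE.
(* Besides the values of [q] outside [E], the points outside ]0, 1[ are discarded because the
   quantile property holds only there. *)
exists (q @^-1` (~` E) `|` ([set 0] `|` [set 1] `|` (~` `[0, 1]))); split.
- apply: measurableU; first exact: mqE.
  by apply: measurableU; [exact: measurableU|exact: measurableC].
- apply: unif01_null_setU.
  + exact: mqE.
  + by apply: measurableU; [exact: measurableU|exact: measurableC].
  + rewrite qlaw; last exact: measurableC.
    rewrite /distribution/= /pushforward (_ : _ @^-1` _ = set0) ?measure0//.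
    apply/seteqP; split=> s //=; apply => n _ /=.
    by rewrite gh (hle _ n).
  + rewrite unif01_itvoo; last first.
      by apply: measurableU; [exact: measurableU|exact: measurableC].
    rewrite (_ : _ `&` _ = set0) ?measure0//.
    apply/seteqP; split=> s //=; rewrite !in_itv/= => -[/andP[s0 s1]] [[s'|s']|].
    * by rewrite s' ltxx in s0.
    * by rewrite s' ltxx in s1.
    * by apply; rewrite !ltW.
move=> s /not_orP[/contrapT Es /not_orP[/not_orP[s0 s1] /contrapT]].
rewrite /= in_itv/= => /andP[s0' s1'] n.
have s01 : 0 < (s : R) < 1.
  by rewrite !lt_neqAle s0' s1' !andbT; apply/andP; split;
    apply/eqP => h01; [apply: s0|apply: s1].
rewrite /= -(Es n I) qP//; congr (_ <= _)%E.
rewrite /distribution/= /pushforward; apply: unif01_eq.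
apply/seteqP; split=> u /= []; rewrite !in_itv/= => u01.
  by rewrite (hle _ n) clipE.
by rewrite (hle _ n) clipE.
Qed.

(** Equal laws have equal cumulative sums, and by [nat_rearrangement] these sums determine the
    rearranged functions off a null set. *)
Lemma nat_matching (k k' : RM -> nat) :
  (forall n, measurable [set s | k s = n]) ->
  (forall n, measurable [set s | k' s = n]) ->
  (forall n, unif01 [set s | k s = n] = unif01 [set s | k' s = n]) ->
  exists a a', [/\ measure_preserving01 a, measure_preserving01 a' &
    exists N, [/\ measurable N, unif01 N = 0%E &
      forall s, ~ N s -> k (a s) = k' (a' s)]].
Proof.
move=> mk mk' kk'.
have kk'le n : unif01 [set s | (k s <= n)%N] = unif01 [set s | (k' s <= n)%N].
  have D (j : RM -> nat) : (forall n, measurable [set s | j s = n]) ->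
      unif01 [set s | (j s <= n)%N] =
      (\sum_(m \in `I_n.+1) unif01 [set s | j s = m])%E.
    move=> mj; rewrite -(@measure_fin_bigcup _ _ _ unif01 _ `I_n.+1
      (fun m => [set s | j s = m]))//; last by move=> i i' _ _ [s [/= <- <-]].
    congr unif01; apply/seteqP.
    by split=> [s js|s [m /= mn jm]]; [exists (j s)|rewrite /= jm].
  by rewrite !D//; apply: eq_fsbigr => m _; exact: kk'.
have [a [aP [N [mN N0 aN]]]] := nat_rearrangement mk.
have [a' [a'P [N' [mN' N'0 aN']]]] := nat_rearrangement mk'.
exists a, a'; split => //; exists (N `|` N'); split.
- exact: measurableU.
- exact: unif01_null_setU.
move=> s /not_orP[sN sN']; apply/eqP; rewrite eqn_leq.
by rewrite aN// kk'le -aN'// leqnn/= aN'// -kk'le -aN// leqnn.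
Qed.

End matching.

(** * Existence of parametrizations *)

Section ternary_expansion.
Context {R : realType}.

Fixpoint ternary_sum (n : nat) (b : nat -> bool) : R :=
  if n is n'.+1 then (b 0)%:R + ternary_sum n' (b \o S) / 3 else 0.

(** The series of b_i / 3^i. With digits 0 and 1 in base 3 the tail after the leading digit is at
    most 1/2, so that digit is 1 exactly when the sum is at least 1. *)
Definition ternary (b : nat -> bool) : R := limn (ternary_sum ^~ b).

Let ternary_sum_bound n b : 0 <= ternary_sum n b <= 3 / 2.
Proof.
elim: n b => [|n IHn] b /=; first by apply/andP; split; lra.
by have /andP[? ?] := IHn (b \o S); case: (b 0) => /=; apply/andP; split; lra.
Qed.

Let ternary_sum_nd b : nondecreasing_seq (ternary_sum ^~ b).
Proof.
apply/nondecreasing_seqP => n; elim: n b => [|n IHn] b /=.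
  by case: (b 0) => /=; lra.
by have /= := IHn (b \o S); lra.
Qed.

Lemma cvg_ternary b : ternary_sum ^~ b @ \oo --> ternary b.
Proof.
apply: nondecreasing_is_cvgn; first exact: ternary_sum_nd.
by exists (3 / 2) => _ [n _ <-]; have /andP[] := ternary_sum_bound n b.
Qed.

Let ternary_rec b : ternary b = (b 0)%:R + ternary (b \o S) / 3.
Proof.
have h := @cvg_ternary b; rewrite -cvg_shiftS in h.
apply: cvg_unique h _ => //.
apply: cvgD; first exact: cvg_cst.
by apply: cvgM; [exact: cvg_ternary|exact: cvg_cst].
Qed.

Let ternary_bound b : 0 <= ternary b <= 3 / 2.
Proof.
apply/andP; split.
  apply: limr_ge; first exact: cvgP (@cvg_ternary b).
  by apply: nearW => n; have /andP[] := ternary_sum_bound n b.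
apply: limr_le; first exact: cvgP (@cvg_ternary b).
by apply: nearW => n; have /andP[] := ternary_sum_bound n b.
Qed.

Let shift (r : R) : R := 3 * (r - (1 <= r)%R%:R).

Let ternary_digit0 b : (1 <= ternary b) = b 0.
Proof.
have /andP[? ?] := ternary_bound (b \o S).
by rewrite ternary_rec; case: (b 0) => /=; apply/idP; lra.
Qed.

Let iter_shift j b : iter j shift (ternary b) = ternary (fun i => b (i + j)%N).
Proof.
elim: j => [|j IHj] /=.
  by congr ternary; apply/funext => i; rewrite addn0.
rewrite IHj /shift ternary_digit0 add0n ternary_rec add0n addrC addKr.
rewrite mulrC divfK//; congr ternary.
by apply/funext => i /=; rewrite addSnnS.
Qed.

Local Notation RM := (measurableTypeR R).

(* [c x] has ternary digits [U i x], hence the i-th one is read off by [D i]. *)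
Lemma measurable_coding d (S : measurableType d) (U : nat -> set S) :
  (forall i, measurable (U i)) ->
  exists (c : S -> RM) (D : nat -> set RM),
    [/\ measurable_fun setT c, (forall i, measurable (D i)) &
        forall i, c @^-1` (D i) = U i].
Proof.
move=> mU; pose b x i := `[< U i x >].
exists (fun x => ternary (b x)), (fun i => [set r | 1 <= iter i shift r]); split.
- apply: (@measurable_fun_cvg _ _ _ _ (fun n x => ternary_sum n (b x))) => [n|x _];
    last exact: cvg_ternary.
  have {}mb i : measurable_fun setT (fun x => (b x i)%:R : R).
    rewrite (_ : (fun x => _) = \1_(U i)); first exact: measurable_indic.
    by apply/funext => x; rewrite indicE /b; congr (_%:R); apply/asboolP/idP; rewrite inE.
  (* The recursion of [ternary_sum] shifts the digits, so the induction needs an arbitrary offset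
     [j]. *)
  suff /(_ 0) : forall j, measurable_fun setT (fun x => ternary_sum n (fun i => b x (i + j)%N)).
    by under eq_fun do under [X in ternary_sum n X]eq_fun do rewrite addn0.
  elim: n => [|n IHn] j /=; first exact: measurable_cst.
  apply: measurable_funD; first exact: mb.
  apply: measurable_funM; last exact: measurable_cst.
  by have := IHn j.+1; under eq_fun do under [X in ternary_sum n X]eq_fun do rewrite addnS.
- move=> i; have mshift : measurable_fun setT (shift : R -> R).
    apply: measurable_funM; first exact: measurable_cst.
    apply: measurable_funB; first exact: measurable_id.
    rewrite (_ : (fun r : R => _) = \1_(`[1, +oo[%classic)); first exact: measurable_indic.
    by apply/funext => r; rewrite indicE mem_setE in_itv/= andbT.
  have miter : measurable_fun setT (iter i shift : R -> R).
    elim: i => [|i IHi]; first exact: measurable_id.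
    exact: (measurableT_comp mshift IHi).
  have := miter measurableT _ (measurable_itv `[1, +oo[).
  rewrite setTI; congr measurable; apply/seteqP.
  by split=> r /=; rewrite in_itv/= andbT.
- move=> i; apply/seteqP; split=> x /=; rewrite iter_shift ternary_digit0 add0n /b.
    by move/asboolP.
  by move=> Ux; apply/asboolP.
Qed.

End ternary_expansion.

(** * Decoding, and parametrizations of arbitrary Borel probabilities *)

Section parametrization_exists.
Context {R : realType} {T : pointedType} (tau : T -> T -> R).
Hypothesis tauL : bounded_lorentzian tau.
Local Notation RM := (measurableTypeR R).
Local Notation TM := (g_sigma_algebraType (coarse_open tau)).

Let v (n : nat) : R := n.+1%:R^-1.

Let v_gt0 n : 0 < v n. Proof. by rewrite /v invr_gt0. Qed.

Let v_small (e : R) : 0 < e -> \forall n \near \oo, v n <= e.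
Proof. exact: near_natSinv_le. Qed.

Lemma measurable_close_closed (F : set TM) : tclose_closed tau F -> measurable F.
Proof. exact: borel_closed. Qed.

(** A countable cover by sets on which every ultrafilter converges. It prevents limits from escaping
    to a spacelike boundary that the space may lack. *)
Let exhaust (k : nat) : set T :=
  [set x | related tau (v k) x \/ spacelike_boundary tau x].

Let exhaustT x : exists k, exhaust k x.
Proof.
have [xb|] := pselect (spacelike_boundary tau x); first by exists 0%N; right.
move=> /existsNP[z /not_andP zx].
suff [e e0 he] : exists2 e, 0 < e & (e <= tau x z \/ e <= tau z x).
  have [N _ /(_ _ (leqnn N)) h] := v_small e0.
  by exists N; left; exists z; case: he => he; [left|right]; exact: le_trans he.
case: zx => /eqP h.
  by exists (tau x z); [rewrite lt_neqAle eq_sym h (lorentzian_ge0 tauL)|left].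
by exists (tau z x); [rewrite lt_neqAle eq_sym h (lorentzian_ge0 tauL)|right].
Qed.

Let exhaust_ultra k (F : set_system T) : UltraFilter F -> F (exhaust k) ->
  exists x, tclose_lim_of tau F x.
Proof.
move=> FU Fk; have [Fr|Fnr] := in_ultra_setVsetC (related tau (v k)) FU.
  exact: (related_ultra tauL (v_gt0 k)).
have [i [[//|ib] _]] := filter_ex (filterI Fk Fnr).
exact: (boundary_ultra tauL ib).
Qed.

Let measurable_prop d (S : measurableType d) (P : Prop) (A : set S) :
  measurable A -> measurable (A `&` [set _ | P]).
Proof.
move=> mA; have [p|np] := pselect P.
  by rewrite (_ : [set _ | P] = setT) ?setIT//; apply/seteqP; split.
by rewrite (_ : [set _ | P] = set0) ?setI0//; apply/seteqP; split.
Qed.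

Section decoding.
Variables (p : nat -> T) (A : nat -> nat -> set RM).
Hypothesis mA : forall n k, measurable (A n k).
Hypothesis Auniq : forall n k l r, A n k r -> A n l r -> k = l.

(** [A n k r] is read as: the code [r] selects the ball of centre [p k] at level [n]. The radii tend
    to zero, so at most one point lies in all selected balls. *)
Let decode (r : RM) (x : T) : Prop :=
  forall n, exists2 k, A n k r & tclose tau (v n) (p k) x.

Let decode_uniq r x y : decode r x -> decode r y -> x = y.
Proof.
move=> rx ry; apply: (tclose_eq tauL) => e e0.
have [N _ /(_ _ (leqnn N)) h] := v_small (divr_gt0 e0 (ltr0n _ 2)).
have [k Ak xk] := rx N; have [l Al yl] := ry N.
rewrite -(Auniq Ak Al) in yl.
by apply: tclose_le (tclose_trans (tclose_sym xk) yl); move: h; rewrite /=; lra.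
Qed.

(** The uncountable existential over [F] becomes countably many conditions: the selected centres are
    pairwise compatible ([C]), and for some [j] every selected ball meets [F] inside [exhaust j]
    ([M j]). A limit of the points of intersection is then the decoded point. *)
Let measurable_decode (F : set T) : tclose_closed tau F ->
  measurable [set r | exists2 x, F x & decode r x].
Proof.
move=> cF.
pose C := \bigcap_n \bigcap_m \bigcup_k \bigcup_l
  ((A n k `&` A m l) `&` [set _ | tclose tau (v n + v m) (p k) (p l)]).
pose M j := C `&` \bigcap_n \bigcup_k
  (A n k `&` [set _ | exists2 x, (F `&` exhaust j) x & tclose tau (v n) (p k) x]).
have mM j : measurable (M j).
  apply: measurableI.
    apply: bigcapT_measurable => n; apply: bigcapT_measurable => m.
    apply: bigcupT_measurable => k; apply: bigcupT_measurable => l.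
    by apply: measurable_prop; exact: measurableI.
  apply: bigcapT_measurable => n; apply: bigcupT_measurable => k.
  exact: measurable_prop.
rewrite (_ : [set r | _] = \bigcup_j M j); first exact: bigcupT_measurable.
apply/seteqP; split=> r.
  move=> [x Fx rx]; have [j jx] := exhaustT x; exists j => //; split.
    move=> n _ m _; have [k Ak kx] := rx n; have [l Al lx] := rx m.
    exists k => //; exists l => //; split => //.
    exact: tclose_trans kx (tclose_sym lx).
  move=> n _; have [k Ak kx] := rx n; exists k => //; split => //.
  by exists x.
move=> [j _ [Cr Fr]].
have [f fP] : exists f : nat -> nat * T, forall n,
    [/\ A n (f n).1 r, F (f n).2, exhaust j (f n).2 &
        tclose tau (v n) (p (f n).1) (f n).2].
  have ex n : exists kx : nat * T, [/\ A n kx.1 r, F kx.2, exhaust j kx.2 &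
        tclose tau (v n) (p kx.1) kx.2].
    by have [k _ [Ak [x [Fx jx] kx]]] := Fr n I; exists (k, x).
  by have [f fP] := choice ex; exists f.
have [U [UU ooU]] := ultraFilterLemma eventually_filter.
have [|x xU] := @exhaust_ultra j _ (ultra_fmap (fun n => (f n).2) UU).
  suff : U [set n | exhaust j (f n).2] by [].
  by apply: filterS filterT => n _ /=; have [] := fP n.
exists x.
  apply: contrapT => nFx; have [e e0 ex] := cF _ nFx.
  have Ue : U [set n | tclose tau e x (f n).2] by exact: xU.
  have [n /ex] := filter_ex Ue.
  by have [_ Fn _ _] := fP n.
move=> n; exists (f n).1; first by have [] := fP n.
(* Passing from [p] at level n to [p] at level m, to the point chosen at level m, to [x] costs
   [v n + v m], [v m] and e/3; for large m this is at most [v n + e]. *)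
apply: tclose_lim => e e0; have e30 : 0 < e / 3 by lra.
have Ue : U [set n | tclose tau (e / 3) x (f n).2] by exact: xU.
have [m [xm vm]] := filter_ex (filterI Ue (ooU _ (v_small e30))).
have [k _ [l _ [[Ak Al] /= kl]]] := Cr n I m I.
have [Am _ _ mm] := fP m; have [An _ _ _] := fP n.
rewrite (Auniq Ak An) (Auniq Al Am) in kl.
apply: tclose_le (tclose_trans (tclose_trans kl mm) (tclose_sym xm)).
by move: vm; rewrite /=; lra.
Qed.

Lemma decoding (c : T -> RM) :
  (forall x n, exists2 k, A n k (c x) & tclose tau (v n) (p k) x) ->
  exists2 g : RM -> TM, measurable_fun setT g & forall x, g (c x) = x.
Proof.
move=> cP; pose g (r : RM) : TM := xget point [set x | decode r x].
exists g; last first.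
  move=> x; have rx : decode (c x) x by exact: cP.
  by rewrite /g; case: xgetP => [y _ ry|/(_ x)//]; exact: decode_uniq ry rx.
have mg (F : set T) : tclose_closed tau F -> measurable (g @^-1` F).
  (* Codes that decode to nothing are sent to [point], hence the second piece when [F] contains
     [point]. *)
  move=> cF; rewrite (_ : _ @^-1` _ = [set r | exists2 x, F x & decode r x] `|`
    ((~` [set r | exists2 x, [set: T] x & decode r x]) `&` [set _ | F point])).
    apply: measurableU; first exact: measurable_decode.
    apply: measurable_prop; apply: measurableC; by apply: measurable_decode => x /(_ I).
  apply/seteqP; split=> r /=; rewrite /g.
    case: xgetP => [y _ ry Fy|nr Fp]; first by left; exists y.
    by right; split=> // -[x _ rx]; exact: nr rx.
  case: xgetP => [y _ /= ry [[x Fx rx]|[nr _]]|nr [[x _ rx]|[]//]].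
  - by rewrite (decode_uniq ry rx).
  - by exfalso; apply: nr; exists y.
  - by have := nr x.
apply: (@measurability _ _ RM TM setT g (coarse_open tau)) => // _ [B oB <-]; rewrite setTI.
rewrite -[X in measurable X]setCK preimage_setC; apply: measurableC; apply: mg.
by rewrite /tclose_closed setCK -(coarse_open_close tauL).
Qed.

End decoding.

(** Each point is coded by a real recording which balls around a dense sequence contain it. The
    quantile function of the law of the code, followed by decoding, has law [m]. *)
Lemma total_parametrization (m : probability TM R) :
  exists2 psi : RM -> TM, measurable_fun setT psi &
    forall B, measurable B -> unif01 (psi @^-1` B) = m B.
Proof.
have [p pP] := dense_sequence tauL.
pose U i : set TM := if unpickle i is Some (n, k) then tclose tau (v n) (p k) else set0.
have mU i : measurable (U i).
  rewrite /U; case: unpickle => [[n k]|//].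
  by apply: measurable_close_closed; exact: tclose_ball_closed.
have [c [mc [D [mD DE]]]] : exists c : TM -> RM, measurable_fun setT c /\
    exists D : nat -> nat -> set RM, (forall n k, measurable (D n k)) /\
      forall n k x, D n k (c x) <-> tclose tau (v n) (p k) x.
  have [c [D [mc mD cD]]] := @measurable_coding R _ _ _ mU.
  exists c; split => //; exists (fun n k => D (pickle (n, k))).
  split=> [n k|n k x]; first exact: mD.
  by rewrite -[D _ _]/((c @^-1` D (pickle (n, k))) x) cD /U pickleK.
(* At each level only the least index of a ball containing the point is kept, so that the selected
   index is unique. *)
pose A (n k : nat) := D n k `\` \bigcup_(j in `I_k) D n j.
have mA n k : measurable (A n k).
  by apply: measurableD => //; apply: bigcup_measurable => j _.
have Auniq n k l r : A n k r -> A n l r -> k = l.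
  move=> [Dk nk] [Dl nl]; case: (ltngtP k l) => // kl; exfalso.
    by apply: nl; exists k.
  by apply: nk; exists l.
have [g mg gc] : exists2 g : RM -> TM, measurable_fun setT g & forall x, g (c x) = x.
  apply: (decoding mA Auniq) => x n.
  have ex : exists k, `[< D n k (c x) >].
    by have [k /DE kx] := pP _ (v_gt0 n) x; exists k; apply/asboolP.
  case: (ex_minnP ex) => k /asboolP Dk kmin; exists k; last by apply/(DE n k x).
  split=> // -[j /= jk Dj]; have /kmin : `[< D n j (c x) >] by exact/asboolP.
  by rewrite leqNgt jk.
pose cm : {mfun TM >-> RM} := HB.pack c (isMeasurableFun.Build _ _ _ _ c mc).
have [q [_ qlaw]] := quantile_exists (distribution m cm).
exists (g \o q); first exact: (measurableT_comp mg).
move=> B mB; rewrite comp_preimage qlaw; last by rewrite -[X in measurable X]setTI; exact: mg.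
rewrite /distribution/= /pushforward; congr (m _).
by apply/seteqP; split=> x /=; rewrite gc.
Qed.

End parametrization_exists.

Lemma parametrization_exists (R : realType) (X : nblmms R) :
  exists psi, parametrization (X := X) psi.
Proof.
have [psi mpsi psiP] := total_parametrization (mm_lorentzian X) (mm_measure X).
exists psi; split; first exact: measurable_funTS.
by move=> B mB; rewrite -psiP// unif01E.
Qed.

(** * The box distance is a pseudometric *)

Section box_theory.
Context {R : realType}.
Local Notation RM := (measurableTypeR R).
Local Notation leb := (@lebesgue_measure R).
Implicit Types u v w : R -> R -> R.

(** Membership of [e] in the set whose infimum is [box u v]. *)
Definition box_close u v (e : R) : Prop := 0 < e /\
  exists Q : set RM,
    [/\ measurable Q, Q `<=` `[0, 1], (leb Q <= e%:E)%E &
        forall s t : R, (`[0, 1] `\` Q) s -> (`[0, 1] `\` Q) t ->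
          `|u s t - v s t| <= e].

Let box_lb u v : lbound [set e | box_close u v e] 0.
Proof. by move=> e [/ltW]. Qed.

Lemma box_close_ne u v : [set e | box_close u v e] !=set0.
Proof.
exists 1; split => //; exists `[0, 1]%classic; split => //.
  by rewrite lebesgue_measure_itv/= lte01 oppr0 adde0.
by move=> s t [].
Qed.

Lemma box_ge0 u v : 0 <= box u v.
Proof. exact: lb_le_inf (box_close_ne u v) (box_lb (v:=v)). Qed.

Lemma box_close_box u v e : box_close u v e -> box u v <= e.
Proof. by move=> uv; apply: ge_inf => //; exists 0; exact: box_lb. Qed.

Lemma box_lt u v e : box u v < e -> box_close u v e.
Proof.
move=> /(inf_lt (box_close_ne u v))[d [d0 [Q [mQ Q01 Qd uv]]] de].
split; first exact: lt_trans de.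
exists Q; split => //; first by apply: le_trans Qd _; rewrite lee_fin ltW.
by move=> s t sQ tQ; apply: le_trans (uv s t sQ tQ) _; exact: ltW.
Qed.

Lemma box_close_sym u v e : box_close u v e -> box_close v u e.
Proof.
move=> [e0 [Q [mQ Q01 Qe uv]]]; split=> //; exists Q; split=> // s t sQ tQ.
by rewrite distrC uv.
Qed.

Lemma box_close_trans v u w e d : box_close u v e -> box_close v w d ->
  box_close u w (e + d).
Proof.
move=> [e0 [Q [mQ Q01 Qe uv]]] [d0 [Q' [mQ' Q'01 Q'd vw]]].
split; first exact: addr_gt0.
exists (Q `|` Q'); split.
- exact: measurableU.
- by rewrite subUset.
- by apply: le_trans (measureU2 leb mQ mQ') _; rewrite EFinD; exact: leeD.
- move=> s t [s01 /not_orP[sQ sQ']] [t01 /not_orP[tQ tQ']].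
  by apply: le_trans (ler_distD (v s t) _ _) _; apply: lerD;
    [exact: uv|exact: vw].
Qed.

Lemma box_close_comp u v e a : measure_preserving01 a -> box_close u v e ->
  box_close (fun s t => u (a s) (a t)) (fun s t => v (a s) (a t)) e.
Proof.
move=> [ma a01 apres] [e0 [Q [mQ Q01 Qe uv]]]; split=> //.
exists (`[0, 1]%classic `&` a @^-1` Q); split.
- by apply: measurableI => //; rewrite -[X in measurable X]setTI; exact: ma.
- exact: subIsetl.
- by rewrite -unif01E apres// unif01E setIidr.
- by move=> s t [s01 /not_andP[//|sQ]] [t01 /not_andP[//|tQ]];
    apply: uv; split => //=; exact: a01.
Qed.

Lemma box_close_null u v e N : 0 < e -> measurable N -> unif01 N = 0%E ->
  (forall s t : RM, ~ N s -> ~ N t -> `|u s t - v s t| <= e) -> box_close u v e.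
Proof.
move=> e0 mN N0 uv; split=> //; exists (`[0, 1]%classic `&` N); split.
- exact: measurableI.
- exact: subIsetl.
- by rewrite -unif01E N0 lee_fin ltW.
- by move=> s t [s01 /not_andP[//|sQ]] [t01 /not_andP[//|tQ]]; exact: uv.
Qed.

End box_theory.

Section borel_sets.
Context {R : realType} {T : choiceType} (tau : T -> T -> R).

Lemma borelC A : borel tau A -> borel tau (~` A).
Proof. by move=> /(@sigma_algebraCD _ _ _ _); rewrite setTD. Qed.

Lemma borel_bigcup (A : nat -> set T) : (forall i, borel tau (A i)) ->
  borel tau (\bigcup_i A i).
Proof. exact: sigma_algebra_bigcup. Qed.

Lemma borelD A B : borel tau A -> borel tau B -> borel tau (A `\` B).
Proof.
move=> bA bB; rewrite setDE -[A `&` _]setCK setCI setCK; apply: borelC.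
rewrite -bigcup2E; apply: borel_bigcup => -[|[|i]] //=; first exact: borelC.
exact: sigma_algebra0.
Qed.

End borel_sets.

(** * Rearranging two maps with the same law *)

Section lorentzian_matching.
Context {R : realType} {T : choiceType} (tau : T -> T -> R).
Hypothesis tauL : bounded_lorentzian tau.
Local Notation RM := (measurableTypeR R).
Local Notation leb := (@lebesgue_measure R).
Local Notation I01 := (`[0%R, 1%R]%classic : set RM).

(** The cell of a point is the index of the first element of a finite e/2-net close to it. Cells are
    differences of sets obtained by successively removing closed balls. *)
Lemma borel_cells (e : R) : 0 < e -> exists k : T -> nat,
  (forall n, borel tau [set x | k x = n]) /\
  (forall x y, k x = k y -> tclose tau e x y).
Proof.
move=> e0; have e20 : 0 < e / 2 by rewrite divr_gt0.
have [s sP] := totally_bounded tauL e20; have [[x0 _] _ _ _ _] := tauL.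
pose P x p := `[< tclose tau (e / 2) p x >].
exists (fun x => find (P x) s); split=> [n|x y kxy]; last first.
  have hx z : tclose tau (e / 2) (nth x0 s (find (P z) s)) z.
    apply/asboolP; rewrite -/(P z _); apply: nth_find; apply/hasP.
    by have [p ps pz] := sP z; exists p => //; apply/asboolP.
  apply: tclose_le (tclose_trans (tclose_sym (hx x)) (_ : tclose tau (e / 2) _ y)).
    by rewrite -splitr.
  by rewrite kxy.
have lt m : borel tau [set x | (m <= find (P x) s)%N].
  elim: m => [|m IHm].
    rewrite (_ : [set _ | _] = setT); first by apply: (borel_open tauL) => x _; exists 1.
    by apply/seteqP; split.
  have [ms|sm] := ltnP m (size s); last first.
    rewrite (_ : [set _ | _] = set0); first exact: sigma_algebra0.
    apply/seteqP; split=> x //= /leq_trans/(_ (find_size _ _)).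
    by rewrite ltnNge sm.
  rewrite (_ : [set _ | _] = [set x | (m <= find (P x) s)%N] `\`
      tclose tau (e / 2) (nth x0 s m)).
    by apply: borelD => //; apply: (borel_closed tauL); exact: tclose_ball_closed.
  apply/seteqP; split=> x /=.
    move=> mx; split; first exact: ltnW.
    by move=> mP; have := before_find x0 mx; rewrite /P => /asboolP; apply.
  move=> [mx nP]; rewrite ltn_neqAle mx andbT; apply/eqP => mE; apply: nP.
  apply/asboolP; rewrite -/(P x _) mE; apply: nth_find.
  by rewrite has_find -mE.
rewrite (_ : [set _ | _] = [set x | (n <= find (P x) s)%N] `\`
  [set x | (n.+1 <= find (P x) s)%N]); first exact: borelD.
apply/seteqP; split=> x /=.
  by move=> ->; rewrite leqnn ltnn.
by move=> [nx /negP]; rewrite -leqNgt => xn; apply/eqP; rewrite eqn_leq xn.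
Qed.

(** The cell indices of [phi] and [phi'] have the same law, so they can be rearranged to agree
    almost everywhere. Points of a common cell are e/2-close, which changes [tau] by at most [e]. *)
Lemma lorentzian_matching (phi phi' : RM -> T) (e : R) : 0 < e ->
  (forall B, borel tau B -> measurable (I01 `&` phi @^-1` B)) ->
  (forall B, borel tau B -> measurable (I01 `&` phi' @^-1` B)) ->
  (forall B, borel tau B ->
     leb (I01 `&` phi @^-1` B) = leb (I01 `&` phi' @^-1` B)) ->
  exists a a', [/\ measure_preserving01 a, measure_preserving01 a' &
    box_close (fun s t => tau (phi (a s)) (phi (a t)))
              (fun s t => tau (phi' (a' s)) (phi' (a' t))) e].
Proof.
move=> e0 mphi mphi' lphi; have e20 : 0 < e / 2 by rewrite divr_gt0.
have [k [bk kP]] := borel_cells e20.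
(* Measurability is known on [0,1] only; the value 0 elsewhere makes the index measurable on R. *)
pose ext (f : RM -> T) (s : RM) : nat := if (0 <= (s : R) <= 1) then k (f s) else 0.
have extE f n : I01 `&` [set s | ext f s = n] =
    I01 `&` f @^-1` [set x | k x = n].
  by apply/seteqP; split=> s /= []; rewrite in_itv/= => s01; rewrite /ext s01.
have mext (f : RM -> T) n : (forall B, borel tau B -> measurable (I01 `&` f @^-1` B)) ->
    measurable [set s | ext f s = n].
  move=> mf; rewrite -(setTI [set _ | _]) -(setUv I01) setIUl extE.
  apply: measurableU; first by apply: mf; exact: bk.
  have [n0|n0] := pselect (0%N = n).
    rewrite (_ : _ `&` _ = ~` I01); first exact: measurableC.
    apply/seteqP; split=> s /=; first by case.
    by rewrite in_itv/= /ext => s01; split=> //; case: ifP => // /s01.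
  rewrite (_ : _ `&` _ = set0)//; apply/seteqP; split=> s //=.
  by rewrite in_itv/= /ext => -[s01]; case: ifP => // /s01.
have [||n|a [a' [aP a'P [N [mN N0 NP]]]]] := @nat_matching R (ext phi) (ext phi').
- by move=> n; exact: mext.
- by move=> n; exact: mext.
- by rewrite !unif01E !extE lphi.
exists a, a'; split=> //; apply: (box_close_null e0 mN N0) => s t sN tN.
have C r : ~ N r -> tclose tau (e / 2) (phi (a r)) (phi' (a' r)).
  move=> /NP; rewrite /ext; have [_ a01 _] := aP; have [_ a'01 _] := a'P.
  by have := a01 r; have := a'01 r; rewrite !in_itv/= => -> ->; exact: kP.
by apply: le_trans (tclose_tau (C s sN) (C t tN)) _; rewrite -splitr.
Qed.

End lorentzian_matching.

(** * Symmetry and triangle inequality of the Lorentzian box distance *)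

Section lorentz_box.
Context {R : realType}.
Local Notation RM := (measurableTypeR R).
Local Notation I01 := (`[0%R, 1%R]%classic : set RM).
Implicit Types X Y Z : nblmms R.

Lemma parametrization_comp X psi a : parametrization (X := X) psi ->
  measure_preserving01 a -> parametrization (X := X) (psi \o a).
Proof.
move=> [mpsi lpsi] [ma a01 apres]; split.
  apply: (@measurable_comp _ _ _ RM RM
    (g_sigma_algebraType (coarse_open (@mm_tau R X))) I01) => //.
    by move=> _ [s _ <-] /=; exact: a01.
  exact: measurable_funTS.
move=> B mB; rewrite -lpsi// -unif01E.
have mpB : measurable (I01 `&` psi @^-1` B) by exact: mpsi.
rewrite (_ : _ @^-1` B = a @^-1` (I01 `&` psi @^-1` B)).
  by rewrite apres// unif01E setIA setIid.
by apply/seteqP; split=> s /=; [split => //; exact: a01|case].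
Qed.

Definition pull X (psi : RM -> g_sigma_algebraType (coarse_open (@mm_tau R X)))
  : R -> R -> R := fun s t => mm_tau (psi s : X) (psi t : X).

Let lb X Y : has_lbound [set r : R | exists psi psi',
    [/\ parametrization (X := X) psi, parametrization (X := Y) psi' &
        r = box (pull (X := X) psi) (pull (X := Y) psi')]].
Proof. by exists 0 => _ [psi [psi' [_ _ ->]]]; exact: box_ge0. Qed.

Lemma lorentz_box_le X Y psi psi' e : parametrization (X := X) psi ->
  parametrization (X := Y) psi' ->
  box_close (pull (X := X) psi) (pull (X := Y) psi') e -> lorentz_box X Y <= e.
Proof.
move=> Ppsi Ppsi' /box_close_box; apply: le_trans; apply: ge_inf.
  exact: lb.
by exists psi, psi'.
Qed.

Lemma lorentz_box_lt X Y e : lorentz_box X Y < e -> exists psi psi',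
  [/\ parametrization (X := X) psi, parametrization (X := Y) psi' &
      box_close (pull (X := X) psi) (pull (X := Y) psi') e].
Proof.
move=> /inf_lt[].
  (* The infimum is approached by elements only if its set is nonempty, which is where
     parametrizations must exist. *)
  have [psi Ppsi] := parametrization_exists X.
  have [psi' Ppsi'] := parametrization_exists Y.
  by eexists; exists psi, psi'.
by move=> _ [psi [psi' [Ppsi Ppsi' ->]]] /box_lt; exists psi, psi'.
Qed.

Lemma lorentz_box_ge0 X Y : 0 <= lorentz_box X Y.
Proof.
rewrite leNgt; apply/negP => /lorentz_box_lt[psi [psi' [_ _ [+ _]]]].
by rewrite ltxx.
Qed.

Lemma lorentz_box_sym X Y : lorentz_box X Y = lorentz_box Y X.
Proof.
have le X' Y' : lorentz_box X' Y' <= lorentz_box Y' X'.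
  apply/ler_addgt0Pr => e e0; set b := lorentz_box Y' X'.
  have /lorentz_box_lt[psi [psi' [P P' h]]] : lorentz_box Y' X' < b + e.
    by rewrite ltrDl.
  exact: lorentz_box_le P' P (box_close_sym h).
by apply/eqP; rewrite eq_le !le.
Qed.

Lemma lorentz_box_triangle Y X Z :
  lorentz_box X Z <= lorentz_box X Y + lorentz_box Y Z.
Proof.
(* One third for each of the two infima, and one for matching the two parametrizations of [Y] that
   they produce. *)
apply/ler_addgt0Pr => e e0; have e30 : 0 < e / 3 by lra.
have /lorentz_box_lt[psi [phi [Ppsi Pphi h1]]] : lorentz_box X Y < lorentz_box X Y + e / 3.
  by rewrite ltrDl.
have /lorentz_box_lt[phi' [chi [Pphi' Pchi h2]]] : lorentz_box Y Z < lorentz_box Y Z + e / 3.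
  by rewrite ltrDl.
have [[mphi lphi] [mphi' lphi']] := (Pphi, Pphi').
have [|||a [a' [aP a'P h3]]] :=
  @lorentzian_matching R Y (@mm_tau R Y) (mm_lorentzian Y) phi phi' (e / 3) e30.
- by move=> B bB; exact: mphi.
- by move=> B bB; exact: mphi'.
- by move=> B bB; rewrite lphi// lphi'.
have := lorentz_box_le (parametrization_comp Ppsi aP) (parametrization_comp Pchi a'P)
  (box_close_trans (box_close_comp aP h1) (box_close_trans h3 (box_close_comp a'P h2))).
lra.
Qed.

End lorentz_box.

(** * The quotient of the support *)

Lemma borel_ind (R : realType) (T : choiceType) (tau : T -> T -> R)
    (P : set_system T) : bounded_lorentzian tau ->
  (forall U, tclose_open tau U -> P U) ->
  (forall A, P A -> P (~` A)) ->
  (forall A : nat -> set T, (forall i, P (A i)) -> P (\bigcup_i A i)) ->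
  forall B, borel tau B -> P B.
Proof.
move=> tauL PO PC PU B; apply: smallest_sub; last first.
  by move=> U; rewrite (coarse_open_close tauL); exact: PO.
split=> //.
- by rewrite -setCT; apply/PC/PO => x _; exists 1.
- by move=> A PA; rewrite setTD; exact: PC.
Qed.

(** The criterion used for the derived spaces: compactness by ultrafilters, with the topology
    supplied by the distinction distance, and separation in contrapositive form. *)
Lemma lorentzian_from_ultra (R : realType) (T : choiceType) (tau : T -> T -> R) :
  [set: T] !=set0 -> (forall x y, 0 <= tau x y) ->
  (forall x y z, 0 < tau x y -> 0 < tau y z -> tau x y + tau y z <= tau x z) ->
  (forall (e : R) (F : set_system (T * T)), 0 < e -> UltraFilter F ->
     F [set p | e <= tau p.1 p.2] ->
     exists x y, forall d, 0 < d ->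
       F [set p | tclose tau d x p.1 /\ tclose tau d y p.2]) ->
  (forall x y, (forall z, tau x z = tau y z /\ tau z x = tau z y) -> x = y) ->
  bounded_lorentzian tau.
Proof.
move=> T0 tau0 tautri tauF tausep; split => //.
  by exists (tclose_topology tau); exact: tclose_topology_admissible.
move=> x y nxy; apply: contrapT => /forallNP n; apply: nxy; apply: tausep => z.
by have /not_orP[/contrapT -> /contrapT ->] := n z.
Qed.

(** * Adjoining the spacelike boundary *)

Section with_i0_theory.
Context {R : realType} {T : choiceType} (tau : T -> T -> R).
Hypothesis tauL : bounded_lorentzian tau.

Let adjoin_lorentzian : ~ (exists i, spacelike_boundary tau i) ->
  bounded_lorentzian (adjoin_tau tau).
Proof.
move=> nb; have [[x0 _] tau0 tautri _ _] := tauL.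
apply: lorentzian_from_ultra.
- by exists None.
- by move=> [x|] [y|] //=; exact: tau0.
- by move=> [x|] [y|] [z|] //=; rewrite ?ltxx//; exact: tautri.
- move=> e F e0 FU Fe; pose d := odflt x0.
  have dF : F [set p | e <= tau (d p.1) (d p.2)].
    by apply: filterS Fe => -[[x|] [y|]] //=; rewrite leNgt e0.
  have [x [y Fxy]] := lorentzian_ultra tauL e0
    (ultra_fmap (fun p => (d p.1, d p.2)) FU) dF.
  exists (Some x), (Some y) => c c0.
  have : F [set p | tclose tau c x (d p.1) /\ tclose tau c y (d p.2)] by exact: Fxy.
  move=> /(@filterI _ F _ _ _ Fe); apply: filterS.
  have cl z w : tclose tau c z w -> tclose (adjoin_tau tau) c (Some z) (Some w).
    by move=> zw [u|] /=; [exact: zw|rewrite subrr normr0 ltW].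
  move=> [[x'|] [y'|]] [/=]; rewrite ?(leNgt e) ?e0//.
  by move=> _ [xx' yy']; split; exact: cl.
- have sepN x : (forall z, adjoin_tau tau (Some x) z = 0 /\
      adjoin_tau tau z (Some x) = 0) -> False.
    by move=> h; apply: nb; exists x => z; have := h (Some z).
  move=> [x|] [y|] //= h.
  + congr Some; apply: (tclose_eq tauL) => e e0 z.
    have [-> ->] : tau x z = tau y z /\ tau z x = tau z y by exact: h (Some z).
    by rewrite !subrr normr0 ltW.
  + by exfalso; apply: (sepN x) => -[z|] //; exact: h (Some z).
  + by exfalso; apply: (sepN y) => -[z|] //; have [<- <-] := h (Some z).
Qed.

Lemma with_i0_lorentzian : bounded_lorentzian (@ext_tau _ _ (with_i0 tau)).
Proof. by rewrite /with_i0; case: pselect => //; exact: adjoin_lorentzian. Qed.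

Lemma with_i0_boundary : exists i, spacelike_boundary (@ext_tau _ _ (with_i0 tau)) i.
Proof.
by rewrite /with_i0; case: pselect => [|?]//; exists None => -[x|].
Qed.

Lemma with_i0_tauE x y :
  @ext_tau _ _ (with_i0 tau) (ext_in _ x) (ext_in _ y) = tau x y.
Proof. by rewrite /with_i0; case: pselect. Qed.

Lemma with_i0_cover (y : with_i0 tau) :
  spacelike_boundary (@ext_tau _ _ (with_i0 tau)) y \/ exists x, y = ext_in _ x.
Proof.
move: y; rewrite /with_i0; case: pselect => [?|?] /=; first by move=> y; right; exists y.
by move=> [x|]; [right; exists x|left => -[z|]].
Qed.

End with_i0_theory.

(** * The support, its quotient and the projection *)

Section support.
Context {R : realType} (X : nblmms R).
Local Notation tau := (@mm_tau R X).
Local Notation m := (mm_measure X).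
Local Notation Y := (spt_i0 X).
Local Notation sigma := (@ext_tau _ _ Y).
Let tauL := mm_lorentzian X.

Lemma spt_closed : tclose_closed tau (@spt R X).
Proof.
move=> x /existsNP[U /not_implyP[oU /not_implyP[Ux nU]]].
have := oU; rewrite (coarse_open_close tauL) => /(_ _ Ux)[e e0 eU].
by exists e => // y /eU Uy /(_ U oU Uy).
Qed.

Lemma measurable_spt : measurable (@spt R X : set (g_sigma_algebraType (coarse_open tau))).
Proof. exact: borel_closed spt_closed. Qed.

(** Every point off the support has a null open neighbourhood, which contains a ball around a member
    of the dense sequence; countably many null balls thus cover the complement. *)
Lemma spt_null : m (~` @spt R X) = 0%E.
Proof.
have [p pP] := dense_sequence tauL.
pose ball (nk : nat * nat) : set X := tclose tau nk.1.+1%:R^-1 (p nk.2).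
have mball nk : measurable (ball nk : set (g_sigma_algebraType (coarse_open tau))).
  by apply: (measurable_close_closed tauL); exact: tclose_ball_closed.
pose B i : set (g_sigma_algebraType (coarse_open tau)) :=
  if unpickle i is Some nk then
    if `[< m (ball nk) = 0%E >] then ball nk else set0 else set0.
have B0 i : m.-negligible (B i).
  rewrite /B; case: unpickle => [nk|]; last exact: negligible_set0.
  case: ifPn => [/asboolP h|_]; last exact: negligible_set0.
  by apply/negligibleP.
apply/negligibleP; first exact: (measurableC measurable_spt).
apply: negligibleS (negligible_bigcup B0).
move=> x /existsNP[U /not_implyP[oU /not_implyP[Ux nU]]].
have := oU; rewrite (coarse_open_close tauL) => /(_ _ Ux)[e e0 eU].
have e20 : 0 < e / 2 by rewrite divr_gt0.
have [N _ /(_ _ (leqnn N)) Ne] := near_natSinv_le e20.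
have v0 : 0 < N.+1%:R^-1 :> R by [].
have [k kx] := pP _ v0 x.
exists (pickle (N, k)) => //; rewrite /B pickleK; case: asboolP => //; case.
apply/eqP; rewrite eq_le measure_ge0 andbT.
have mU0 : (m U <= 0)%E by rewrite leNgt; apply/negP.
apply: le_trans mU0; apply: le_measure; rewrite ?inE//.
  exact: sub_sigma_algebra.
move=> y ky; apply: eU; apply: tclose_le (tclose_trans (tclose_sym kx) ky).
by rewrite [leRHS]splitr lerD.
Qed.

Lemma spt_nonempty : exists x, @spt R X x.
Proof.
apply: contrapT => /forallNP n.
have : m (~` @spt R X) = 1%E.
  rewrite (_ : ~` _ = setT) ?probability_setT//.
  by apply/seteqP; split=> // x _; exact: n.
by rewrite spt_null => /esym/eqP; rewrite onee_eq0.
Qed.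

(** Limits of representatives remain in the support, which is closed. Projecting does not increase
    the distinction distance, because fewer points are available to distinguish. *)
Lemma spt_quot_lorentzian : bounded_lorentzian (@spt_tau R X).
Proof.
have [_ tau0 tautri _ _] := tauL; have [x0 sx0] := spt_nonempty.
have qK (c : spt_quot X) : spt_q (repr c) = c by exact: reprK.
apply: lorentzian_from_ultra.
- by exists (spt_q (exist _ x0 (mem_set sx0))).
- by move=> a b; exact: tau0.
- by move=> a b c; exact: tautri.
- move=> e F e0 FU Fe.
  pose f (c : spt_quot X) : X := val (repr c).
  have [x [y Fxy]] := lorentzian_ultra tauL e0 (ultra_fmap (fun p => (f p.1, f p.2)) FU) Fe.
  have clos (z : X) (g : spt_quot X * spt_quot X -> X) :
      (forall p, spt (g p)) -> (forall d, 0 < d -> F [set p | tclose tau d z (g p)]) -> spt z.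
    move=> gs Fz; apply: contrapT => nz; have [d d0 dz] := spt_closed nz.
    by have [p /dz] := filter_ex (Fz d d0); apply; exact: gs.
  have fs c : spt (f c) by apply/set_mem/valP.
  have sx : spt x.
    apply: (clos x (fun p => f p.1)) => [p|d d0]; first exact: fs.
    have : F [set p | tclose tau d x (f p.1) /\ tclose tau d y (f p.2)] by exact: Fxy.
    by apply: filterS => p [].
  have sy : spt y.
    apply: (clos y (fun p => f p.2)) => [p|d d0]; first exact: fs.
    have : F [set p | tclose tau d x (f p.1) /\ tclose tau d y (f p.2)] by exact: Fxy.
    by apply: filterS => p [].
  have cl (z : X) (sz : spt z) d c : tclose tau d z (f c) ->
      tclose (@spt_tau R X) d (spt_q (exist _ z (mem_set sz))) c.
    move=> zc w; rewrite -(qK w) !spt_tauE -(qK c) !spt_tauE /=.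
    by have := zc (f w).
  exists (spt_q (exist _ x (mem_set sx))), (spt_q (exist _ y (mem_set sy))) => d d0.
  have : F [set p | tclose tau d x (f p.1) /\ tclose tau d y (f p.2)] by exact: Fxy.
  by apply: filterS => p [h1 h2]; split; exact: cl.
- move=> a b h; rewrite -(qK a) -(qK b); apply/(@eqmodP _ (spt_sim_equivRel X)).
  apply/asboolP => z; have := h (spt_q z).
  by rewrite -{1 2}(qK a) -{1 2}(qK b) !spt_tauE.
Qed.

Lemma spt_i0_lorentzian : bounded_lorentzian sigma.
Proof. exact/with_i0_lorentzian/spt_quot_lorentzian. Qed.

Lemma spt_i0_boundary : exists i, spacelike_boundary sigma i.
Proof. exact: with_i0_boundary. Qed.

Lemma spt_projection : exists Theta : X -> Y,
  [/\ (forall x y, spt x -> spt y -> sigma (Theta x) (Theta y) = tau x y),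
      (forall x y e, 0 <= e -> spt x -> spt y -> tclose tau e x y ->
        tclose sigma e (Theta x) (Theta y)),
      (forall y, spacelike_boundary sigma y \/ exists2 x, spt x & y = Theta x),
      (forall B, borel sigma B -> borel tau (Theta @^-1` B)) &
      (forall B, borel sigma B -> spt_i0_push B = m (Theta @^-1` B))].
Proof.
have [x0 sx0] := spt_nonempty.
pose s0 : @spt R X := exist _ x0 (mem_set sx0).
(* The projection is extended to all of X by the constant class of [s0] off the support, a null set,
   so that the push-forward becomes an ordinary image measure. *)
pose Theta (x : X) : Y := ext_in Y (spt_q (insubd s0 x)).
have tauE x y : spt x -> spt y -> sigma (Theta x) (Theta y) = tau x y.
  move=> sx sy; rewrite /Theta with_i0_tauE spt_tauE !insubdK//; exact: mem_set.
have cover y : spacelike_boundary sigma y \/ exists2 x, spt x & y = Theta x.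
  have [|[c ->]] := with_i0_cover y; [by left|right].
  exists (val (repr c)); first exact/set_mem/valP.
  by rewrite /Theta valKd; congr ext_in; rewrite /spt_q reprK.
have cl x y e : 0 <= e -> spt x -> spt y -> tclose tau e x y -> tclose sigma e (Theta x) (Theta y).
  move=> e0 sx sy xy z; have [zb|[w sw ->]] := cover z.
    by have [-> ->] := zb (Theta x); have [-> ->] := zb (Theta y); rewrite subrr normr0.
  by rewrite !tauE//; exact: xy.
have bTheta B : borel sigma B -> borel tau (@spt R X `&` Theta @^-1` B).
  pose bs := borel_closed tauL spt_closed.
  apply: (borel_ind spt_i0_lorentzian (P := fun B => borel tau (@spt R X `&` Theta @^-1` B))).
  - move=> U oU.
    (* The removed set is closed in X, since the support is closed and [Theta] does not increase the
       distinction distance on it. *)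
    rewrite (_ : _ `&` _ = @spt R X `\` (@spt R X `&` Theta @^-1` (~` U))).
      apply: borelD => //; apply: (borel_closed tauL) => x.
      have [sx|nsx] := pselect (spt x); last first.
        by move=> _; have [e e0 ex] := spt_closed nsx; exists e => // y /ex ? [].
      move=> /not_andP[//|/contrapT Ux]; have [e e0 eU] := oU _ Ux.
      exists e => // y xy [sy]; apply; apply: eU; apply: cl => //; exact: ltW.
    apply/seteqP; split=> x /= [sx h]; split=> //; first by case.
    by apply: contrapT => nU; apply: h.
  - move=> A bA; rewrite (_ : _ `&` _ = @spt R X `\` (@spt R X `&` Theta @^-1` A)).
      exact: borelD.
    by apply/seteqP; split=> x /= [sx h]; split=> //; [case|move=> h'; apply: h].
  - by move=> A bA; rewrite preimage_bigcup setI_bigcupr; exact: borel_bigcup.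
have nTheta (B : set Y) : ~` @spt R X `&` Theta @^-1` B =
    ~` @spt R X `&` [set _ | B (ext_in Y (spt_q s0))].
  apply/seteqP; split=> x /= [nsx]; rewrite /Theta /insubd insubN//.
  - by apply/negP => /set_mem.
  - by apply/negP => /set_mem.
have bTheta' B : borel sigma B -> borel tau (Theta @^-1` B).
  move=> bB; rewrite -[X in borel tau X]setTI -(setUv (@spt R X)) setIUl nTheta.
  have [b|nb] := pselect (B (ext_in Y (spt_q s0))).
    rewrite (_ : [set _ | _] = setT) ?setIT; last by apply/seteqP; split.
    apply: (@measurableU _ (g_sigma_algebraType (coarse_open tau))).
      exact: bTheta.
    exact: (measurableC measurable_spt).
  rewrite (_ : [set _ | _] = set0) ?setI0 ?setU0; first exact: bTheta.
  by apply/seteqP; split.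
exists Theta; split=> // B bB.
rewrite /spt_i0_push /spt_push (_ : _ @` _ = @spt R X `&` Theta @^-1` B).
  apply/eqP; rewrite eq_le; apply/andP; split.
    apply: le_measure; rewrite ?inE; [exact: bTheta|exact: bTheta'|exact: subIsetr].
  rewrite -[leRHS]adde0 -spt_null.
  have mS := bTheta _ bB.
  apply: le_trans (measureU2 m mS (measurableC measurable_spt)).
  apply: le_measure; rewrite ?inE; [exact: bTheta'| |].
    apply: (@measurableU _ (g_sigma_algebraType (coarse_open tau))) => //.
    exact: (measurableC measurable_spt).
  by move=> x Bx; have [sx|nsx] := pselect (spt x); [left|right].
apply/seteqP; split=> x /=.
  by move=> [z Bz <-]; split; [exact/set_mem/valP|rewrite /Theta valKd].
move=> [sx]; rewrite /Theta => h; exists (insubd s0 x) => //.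
by rewrite insubdK//; exact: mem_set.
Qed.

End support.

(** * Uniqueness of laws *)

Section closed_domination.
Context {R : realType} {T : pointedType} (tau : T -> T -> R).
Hypothesis tauL : bounded_lorentzian tau.
Local Notation TM := (g_sigma_algebraType (coarse_open tau)).
Implicit Types P : probability TM R.

Let v (n : nat) : R := n.+1%:R^-1.

(** The closed enlargements decrease to [F], so continuity from above applies. *)
Lemma le_measure_enlarge P (F : set TM) (c : \bar R) : tclose_closed tau F ->
  (forall k, c <= P (enlarge tau F (v k)) + (v k)%:E)%E -> (c <= P F)%E.
Proof.
move=> cF cP.
have vle k l : (k <= l)%N -> v l <= v k.
  by move=> kl; rewrite /v lef_pV2 ?posrE// ler_nat.
have FE : F = \bigcap_k enlarge tau F (v k).
  apply/seteqP; split=> [x Fx k _|]; first by apply: sub_enlarge; rewrite ?invr_ge0.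
  apply: bigcap_enlarge => // e e0.
  by have [n _ /(_ _ (leqnn n))] := near_natSinv_le e0; exists n.
have menl k : measurable (enlarge tau F (v k) : set TM).
  by apply: (measurable_close_closed tauL); exact: enlarge_closed.
have cv : P (enlarge tau F (v k)) @[k --> \oo] --> P F.
  rewrite [X in _ --> P X]FE; apply: nonincreasing_cvg_mu => //.
  - by rewrite (le_lt_trans (probability_le1 _ _)) ?ltry//=.
  - exact: bigcapT_measurable.
  - move=> k l kl; apply/subsetPset => x Fx d d0; have [y Fy yx] := Fx d d0.
    by exists y => //; apply: tclose_le yx; rewrite lerD2r vle.
have cv' : (P (enlarge tau F (v k)) + (v k)%:E)%E @[k --> \oo] --> (P F + 0%R%:E)%E.
  apply: cvgeD => //; first by rewrite fin_num_adde_defl.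
  apply/fine_cvgP; split; first by apply: nearW.
  apply/cvgrPdist_le => e e0; apply: filterS (near_natSinv_le e0) => n ne /=.
  by rewrite sub0r normrN ger0_norm// invr_ge0.
rewrite -[leRHS]adde0; apply: cvge_ge cv'; exact: nearW.
Qed.

(** Complements reverse the inequality on open sets. An open set between [F] and its enlargement
    then yields the converse inequality on [F], and open sets form a generating system closed under
    intersection. *)
Lemma closed_domination_eq (P P' : probability TM R) :
  (forall F : set TM, tclose_closed tau F -> (P F <= P' F)%E) ->
  forall B, measurable B -> P B = P' B.
Proof.
move=> PP'.
have mO (U : set TM) : tclose_open tau U -> measurable U.
  by move=> oU; apply: (borel_open tauL).
have cl (F : set TM) : tclose_closed tau F -> P F = P' F.
  move=> cF; apply/eqP; rewrite eq_le PP'//=.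
  apply: le_measure_enlarge => // k.
  pose W : set TM := [set y | exists2 d, 0 < d & tclose tau d y `<=` enlarge tau F (v k)].
  have oW : tclose_open tau W by exact: tclose_interior_open.
  have mW := mO _ oW.
  have FW : F `<=` W.
    move=> x Fx; exists (v k) => [|y xy d d0]; first by rewrite invr_gt0.
    by exists x => //; apply: tclose_le xy; rewrite lerDl ltW.
  have WF : W `<=` enlarge tau F (v k).
    by move=> y [d d0]; apply; apply: tclosexx; exact: ltW.
  have mF : measurable F by exact: (measurable_close_closed tauL).
  apply: (@le_trans _ _ (P' W)); first by apply: le_measure; rewrite ?inE.
  apply: (@le_trans _ _ (P W)).
    have cW : tclose_closed tau (~` W) by rewrite /tclose_closed setCK.
    have := PP' _ cW; rewrite !probability_setC//.
    by rewrite leeD2lE// leeN2.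
  have menl : measurable (enlarge tau F (v k) : set TM).
    by apply: (measurable_close_closed tauL); exact: enlarge_closed.
  apply: (@le_trans _ _ (P (enlarge tau F (v k)))).
    by apply: le_measure; rewrite ?inE.
  by rewrite leeDl// lee_fin invr_ge0.
move=> B mB.
apply: (@measure_unique _ R TM (coarse_open tau) (fun=> setT)) => //.
- rewrite (coarse_open_close tauL) => A C oA oC.
  exact: (@opensI _ (tclose_topology tau)).
- by move=> _; rewrite (coarse_open_close tauL); exact: (opensT (tclose_topology tau)).
- by rewrite bigcup_const.
- move=> U cU0; have oU : tclose_open tau U by rewrite -(coarse_open_close tauL).
  have cU : tclose_closed tau (~` U) by rewrite /tclose_closed setCK.
  have QE (Q : probability TM R) : Q U = (1 - Q (~` U))%E.
    have := @probability_setC _ TM _ Q (~` U) (measurableC (mO _ oU)).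
    by rewrite setCK.
  by have := QE P'; rewrite -(cl _ cU) -QE => /esym.
- by move=> _; apply: (le_lt_trans (@probability_le1 _ TM R P setT measurableT)); exact: ltry.
Qed.

End closed_domination.

(** * Comparing the laws of two maps on [0,1] *)

Section law.
Context {R : realType} {T : pointedType} (tau : T -> T -> R).
Hypothesis tauL : bounded_lorentzian tau.
Local Notation RM := (measurableTypeR R).
Local Notation leb := (@lebesgue_measure R).
Local Notation I01 := (`[0%R, 1%R]%classic : set RM).
Local Notation TM := (g_sigma_algebraType (coarse_open tau)).

Lemma law_probability (phi : RM -> T) :
  (forall B, borel tau B -> measurable (I01 `&` phi @^-1` B)) ->
  exists P : probability TM R,
    forall B, borel tau B -> P B = leb (I01 `&` phi @^-1` B).
Proof.
move=> mphi; pose f (s : RM) : TM := if 0 <= (s : R) <= 1 then phi s else point.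
have mf : measurable_fun setT f.
  apply: measurable_fun_if => //.
  - apply: (@measurable_fun_bool _ _ _ _ true); rewrite setTI.
    by rewrite (_ : _ @^-1` _ = I01).
  - move=> _ B mB; rewrite setTI (_ : _ @^-1` [set true] = I01); last first.
      by apply/seteqP; split.
    exact: mphi.
pose fm : {mfun RM >-> TM} := HB.pack f (isMeasurableFun.Build _ _ _ _ f mf).
exists (distribution unif01 fm) => B bB.
rewrite /distribution/= /pushforward unif01E; congr leb.
by apply/seteqP; split=> s /= []; rewrite in_itv/= /f => s01; rewrite s01.
Qed.

(** One half of a Prokhorov estimate, valid at every scale, forces equality of the laws. *)
Lemma closed_domination_law (phi phi' : RM -> T) :
  (forall B, borel tau B -> measurable (I01 `&` phi @^-1` B)) ->
  (forall B, borel tau B -> measurable (I01 `&` phi' @^-1` B)) ->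
  (forall F, tclose_closed tau F -> forall k : nat,
    (leb (I01 `&` phi @^-1` F) <=
     leb (I01 `&` phi' @^-1` (enlarge tau F k.+1%:R^-1)) + (k.+1%:R^-1)%:E)%E) ->
  forall B, borel tau B -> leb (I01 `&` phi @^-1` B) = leb (I01 `&` phi' @^-1` B).
Proof.
move=> mphi mphi' dom B bB.
have [P PE] := law_probability mphi; have [P' P'E] := law_probability mphi'.
rewrite -PE// -P'E//; apply: (closed_domination_eq tauL) => // F cF.
apply: (le_measure_enlarge tauL cF) => k.
rewrite PE; last exact: (borel_closed tauL).
rewrite P'E; first exact: dom.
by apply: (borel_closed tauL); exact: enlarge_closed.
Qed.

End law.

(** * Limits of approximate isometries *)

Section shadow.
Context {R : realType}.
Local Notation RM := (measurableTypeR R).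

(* [p] and [p'] are limits along [U] of corresponding points of the
   approximate isometries [th n t |-> th' n t], t in [G n]. *)
Definition shadow (Y Y' : choiceType) (sg : Y -> Y -> R) (sg' : Y' -> Y' -> R)
    (th : nat -> RM -> Y) (th' : nat -> RM -> Y') (G : nat -> set RM)
    (U : set_system nat) (p : Y) (p' : Y') : Prop :=
  forall d, 0 < d -> U [set n | forall t, G n t ->
    `|sg p (th n t) - sg' p' (th' n t)| <= d /\
    `|sg (th n t) p - sg' (th' n t) p'| <= d].

Definition approximable (Y : choiceType) (sg : Y -> Y -> R)
    (th : nat -> RM -> Y) (G : nat -> set RM) (U : set_system nat) (p : Y) : Prop :=
  forall e, 0 < e -> U [set n | exists2 t, G n t & tclose sg e p (th n t)].

Definition almost_isometric (Y Y' : choiceType) (sg : Y -> Y -> R)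
    (sg' : Y' -> Y' -> R) (th : nat -> RM -> Y) (th' : nat -> RM -> Y')
    (G : nat -> set RM) (U : set_system nat) : Prop :=
  forall d, 0 < d -> U [set n | forall s t, G n s -> G n t ->
    `|sg (th n s) (th n t) - sg' (th' n s) (th' n t)| <= d].

Section one_sided.
Context {Y Y' : choiceType} {sg : Y -> Y -> R} {sg' : Y' -> Y' -> R}.
Context {th : nat -> RM -> Y} {th' : nat -> RM -> Y'} {G : nat -> set RM}.
Context {U : set_system nat}.

Lemma shadow_sym p p' : shadow sg sg' th th' G U p p' ->
  Filter U -> shadow sg' sg th' th G U p' p.
Proof.
move=> pp' FU d d0; apply: filterS (pp' d d0) => n nP t Gt.
by have [h1 h2] := nP t Gt; split; rewrite distrC.
Qed.

Lemma almost_isometric_sym : almost_isometric sg sg' th th' G U -> Filter U ->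
  almost_isometric sg' sg th' th G U.
Proof.
move=> iso FU d d0; apply: filterS (iso d d0) => n nP s t Gs Gt.
by rewrite distrC; exact: nP.
Qed.

(* The limit point is taken along an ultrafilter on pairs (n, t) projecting
   onto U and along which [th n t] tends to [p]. *)
Lemma approximable_shadow (UU : UltraFilter U) : bounded_lorentzian sg' ->
  (exists i, spacelike_boundary sg' i) -> almost_isometric sg sg' th th' G U ->
  forall p, approximable sg th G U p -> exists p', shadow sg sg' th th' G U p p'.
Proof.
move=> sgL' [i' i'b] iso p pa.
pose B (Ae : set nat * R) : set (nat * RM) := [set nt |
  [/\ Ae.1 nt.1, G nt.1 nt.2 & tclose sg Ae.2 p (th nt.1 nt.2)]].
have FB : ProperFilter (filter_from [set Ae | U Ae.1 /\ 0 < Ae.2] B).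
  apply: filter_from_proper; last first.
    move=> [A e] [/= UA e0]; have [n [An [t Gt pt]]] := filter_ex (filterI UA (pa e e0)).
    by exists (n, t).
  apply: filter_from_filter; first by exists (setT, 1); split => //; exact: filterT.
  move=> [A e] [C d] [/= UA e0] [/= UC d0]; exists (A `&` C, Num.min e d).
    by split => /=; [exact: filterI|rewrite lt_min e0].
  move=> [n t] [/= [An Cn] Gt pt]; split; split => //=; apply: tclose_le pt.
    by rewrite ge_min lexx.
  by rewrite ge_min lexx orbT.
have [V [VU BV]] := ultraFilterLemma FB.
(* The projection of [V] is a proper filter containing [U], hence equals it by maximality. *)
have VE : [set A | V (fst @^-1` A)] = U.
  have PF : ProperFilter (fst @ V) by exact: fmap_proper_filter.
  apply: (@max_filter _ U UU _ PF) => A UA.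
  suff : V (fst @^-1` A) by [].
  by apply: BV; exists (A, 1) => // -[n t] [].
have [p' p'V] := boundary_ultra sgL' i'b (ultra_fmap (fun nt => th' nt.1 nt.2) VU).
exists p' => d d0; have d30 : 0 < d / 3 by lra.
have Visom : V (fst @^-1` [set n | forall s t, G n s -> G n t ->
    `|sg (th n s) (th n t) - sg' (th' n s) (th' n t)| <= d / 3]).
  by have := iso _ d30; rewrite -{1}VE.
have Vp' : V [set nt | tclose sg' (d / 3) p' (th' nt.1 nt.2)] by exact: p'V.
have Vp : V (B (setT, d / 3)).
  by apply: BV; exists (setT, d / 3) => //; split=> //; exact: filterT.
pose N : set nat := [set n | forall t, G n t ->
    `|sg p (th n t) - sg' p' (th' n t)| <= d /\
    `|sg (th n t) p - sg' (th' n t) p'| <= d].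
(* With [th n t] near [p] and [th' n t] near [p'], the value at (p, th n s) is compared through (th
   n t, th n s) and (th' n t, th' n s), each step costing d/3; likewise in the other order. *)
suff VN : V (fst @^-1` N) by rewrite -VE.
apply: filterS (filterI Visom (filterI Vp' Vp)) => -[n t] [/= nI [p't [_ Gt pt]]] s Gs.
have [a1 a2] := pt (th n s); have [b1 b2] := p't (th' n s).
have c1 := nI t s Gt Gs; have c2 := nI s t Gs Gt.
move: a1 a2 b1 b2 c1 c2 => /=; rewrite !ler_distl.
move=> /andP[? ?] /andP[? ?] /andP[? ?] /andP[? ?] /andP[? ?] /andP[? ?].
by split; apply/andP; split; lra.
Qed.

(** Boundary points are treated apart: they may carry no mass and then need not be approximable. *)
Lemma boundary_shadow (UU : Filter U) p p' : spacelike_boundary sg p ->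
  spacelike_boundary sg' p' -> shadow sg sg' th th' G U p p'.
Proof.
move=> pb p'b d d0; apply: filterS filterT => n _ t _.
by have [-> ->] := pb (th n t); have [-> ->] := p'b (th' n t);
  rewrite subrr normr0 ltW.
Qed.

Lemma boundary_approximable_shadow_tau (UU : UltraFilter U) p p' r :
  shadow sg sg' th th' G U p p' ->
  spacelike_boundary sg' p' -> approximable sg th G U r ->
  sg p r = 0 /\ sg r p = 0.
Proof.
move=> pp' p'b ra.
suff h d : 0 < d -> `|sg p r| <= 0 + d /\ `|sg r p| <= 0 + d.
  by split; apply/eqP; rewrite -normr_le0; apply/ler_addgt0Pr => d /h[].
move=> d0; have d20 : 0 < d / 2 by lra.
have [n [np [t Gt rt]]] := filter_ex (filterI (pp' _ d20) (ra _ d20)).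
have [a1 a2] := np t Gt; have [b1 b2] := rt p.
have [c1 c2] := p'b (th' n t); rewrite c1 c2 in a1 a2.
move: a1 a2 b1 b2 => /=; rewrite !subr0 add0r !ler_norml.
move=> /andP[? ?] /andP[? ?] /andP[? ?] /andP[? ?].
by split; apply/andP; split; lra.
Qed.

Lemma approximable_shadow_tau (UU : UltraFilter U) p p' r r' :
  almost_isometric sg sg' th th' G U ->
  shadow sg sg' th th' G U p p' -> shadow sg sg' th th' G U r r' ->
  approximable sg' th' G U p' -> approximable sg th G U r ->
  sg p r = sg' p' r'.
Proof.
move=> iso pp' rr' p'a ra; apply/eqP; rewrite -subr_eq0 -normr_le0.
apply/ler_addgt0Pr => d d0; rewrite add0r; have d70 : 0 < d / 7 by lra.
have [n [nI [np [nr [[s Gs p's] [t Gt rt]]]]]] :=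
  filter_ex (filterI (iso _ d70) (filterI (pp' _ d70) (filterI (rr' _ d70)
    (filterI (p'a _ d70) (ra _ d70))))).
(* The seven comparisons lead from (p, r) through (p, th t), (p', th' t), (th' s, th' t), (th s, th
   t), (th s, r) and (th' s, r') to (p', r'). *)
have [_ a] := rt p; have [b _] := np t Gt; have c := nI s t Gs Gt.
have [_ e] := nr s Gs; have [f _] := p's r'; have [_ g] := rt (th n s).
have [h _] := p's (th' n t).
move: a b c e f g h => /=; rewrite !ler_distl.
move=> /andP[? ?] /andP[? ?] /andP[? ?] /andP[? ?] /andP[? ?] /andP[? ?] /andP[? ?].
by apply/andP; split; lra.
Qed.

End one_sided.

Section two_sided.
Context {Y Y' : choiceType} {sg : Y -> Y -> R} {sg' : Y' -> Y' -> R}.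
Context {th : nat -> RM -> Y} {th' : nat -> RM -> Y'} {G : nat -> set RM}.
Context {U : set_system nat} {UU : UltraFilter U}.
Hypothesis iso : almost_isometric sg sg' th th' G U.
Hypothesis full : forall p, spacelike_boundary sg p \/ approximable sg th G U p.
Hypothesis full' : forall p, spacelike_boundary sg' p \/ approximable sg' th' G U p.

Lemma shadow_exists : bounded_lorentzian sg' ->
  (exists i, spacelike_boundary sg' i) ->
  forall p, exists p', shadow sg sg' th th' G U p p'.
Proof.
move=> sgL' bd p; have [pb|pa] := full p; last exact: approximable_shadow.
by have [i ib] := bd; exists i; exact: boundary_shadow.
Qed.

Lemma shadow_tau p p' r r' :
  shadow sg sg' th th' G U p p' -> shadow sg sg' th th' G U r r' ->
  sg p r = sg' p' r'.
Proof.
move=> pp' rr'.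
have [p'b|p'a] := full' p'.
  rewrite (p'b r').1; have [rb|ra] := full r; first by rewrite (rb p).2.
  by have [] := boundary_approximable_shadow_tau UU pp' p'b ra.
have [rb|ra] := full r; last exact: approximable_shadow_tau iso pp' rr' p'a ra.
rewrite (rb p).2.
by have [_ ->] := boundary_approximable_shadow_tau UU (shadow_sym rr' _) rb p'a.
Qed.

End two_sided.

End shadow.

(** * Reconstructing an isomorphism from vanishing box distance *)

Section reconstruction.
Context {R : realType}.
Local Notation RM := (measurableTypeR R).
Local Notation leb := (@lebesgue_measure R).
Local Notation I01 := (`[0%R, 1%R]%classic : set RM).

Definition realizes (Y : choiceType) (sg : Y -> Y -> R) (mu : set Y -> \bar R)
    (phi : RM -> Y) : Prop :=
  (forall B, borel sg B -> measurable (I01 `&` phi @^-1` B)) /\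
  (forall B, borel sg B -> leb (I01 `&` phi @^-1` B) = mu B).

(** The exception is for an adjoined spacelike boundary, which has mass zero. *)
Definition full_support (Y : choiceType) (sg : Y -> Y -> R) (mu : set Y -> \bar R) :=
  forall p, spacelike_boundary sg p \/
    forall e, 0 < e -> (0 < mu (tclose sg e p))%E.

(** A ball of positive mass has a preimage too large to lie in the exceptional set [Q n] once n is
    large. *)
Lemma full_support_approximable (Y : choiceType) (sg : Y -> Y -> R)
    (mu : set Y -> \bar R) (th : nat -> RM -> Y) (Q : nat -> set RM)
    (U : set_system nat) :
  bounded_lorentzian sg -> UltraFilter U -> \oo `<=` U ->
  (forall n, realizes sg mu (th n)) ->
  (forall n, measurable (Q n) /\ (leb (Q n) <= (n.+1%:R^-1)%:E)%E) ->
  full_support sg mu ->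
  forall p, spacelike_boundary sg p \/ approximable sg th (fun n => I01 `\` Q n) U p.
Proof.
move=> sgL UU ooU real QP full p; have [pb|pf] := full p; [by left|right].
move=> e e0; have mup := pf e e0.
have bp : borel sg (tclose sg e p).
  by apply: (borel_closed sgL); exact: tclose_ball_closed.
have [d d0 dmu] : exists2 d : R, 0 < d & (d%:E < mu (tclose sg e p))%E.
  have [_ /(_ _ bp) lE] := real 0%N.
  have : mu (tclose sg e p) \is a fin_num.
    rewrite -lE ge0_fin_numE//; apply: (@le_lt_trans _ _ (leb I01)).
      apply: le_measure; rewrite ?inE//; first by have [/(_ _ bp)] := real 0%N.
    by rewrite lebesgue_measure_itv/= lte01 ltry.
  move=> /fineK muE; exists (fine (mu (tclose sg e p)) / 2).
    by rewrite divr_gt0// -lte_fin muE.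
  rewrite -[ltRHS]muE lte_fin; have : 0 < fine (mu (tclose sg e p)) by rewrite -lte_fin muE.
  by lra.
apply: filterS (ooU _ (near_natSinv_le d0)) => n /= nd; apply: contrapT => no.
have [mn /(_ _ bp) ln] := real n; have [mQ Qn] := QP n.
suff : (mu (tclose sg e p) <= leb (Q n))%E.
  rewrite leNgt => /negP; apply; apply: le_lt_trans dmu.
  by apply: le_trans Qn _; rewrite lee_fin.
rewrite -ln; apply: le_measure; rewrite ?inE//; first exact: mn.
move=> t [It pt]; apply: contrapT => Qt; apply: no; by exists t.
Qed.

Lemma reconstruction (Y Y' : choiceType) (sg : Y -> Y -> R) (sg' : Y' -> Y' -> R)
    (mu : set Y -> \bar R) (mu' : set Y' -> \bar R)
    (th : nat -> RM -> Y) (th' : nat -> RM -> Y') :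
  bounded_lorentzian sg -> bounded_lorentzian sg' ->
  (exists i, spacelike_boundary sg i) -> (exists i, spacelike_boundary sg' i) ->
  full_support sg mu -> full_support sg' mu' ->
  (forall n, realizes sg mu (th n)) -> (forall n, realizes sg' mu' (th' n)) ->
  (forall n, box_close (fun s t => sg (th n s) (th n t))
     (fun s t => sg' (th' n s) (th' n t)) n.+1%:R^-1) ->
  exists iota : Y -> Y',
    [/\ (forall B, borel sg' B -> borel sg (iota @^-1` B)),
        (forall x y, sg x y = sg' (iota x) (iota y)) &
        (forall B, borel sg' B -> mu (iota @^-1` B) = mu' B)].
Proof.
move=> sgL sgL' bd bd' full full' real real' box.
have [Q QP] : exists Q : nat -> set RM, forall n,
    [/\ measurable (Q n), (leb (Q n) <= (n.+1%:R^-1)%:E)%E &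
      forall s t, (I01 `\` Q n) s -> (I01 `\` Q n) t ->
       `|sg (th n s) (th n t) - sg' (th' n s) (th' n t)| <= n.+1%:R^-1].
  have ex n : exists Q : set RM, [/\ measurable Q, (leb Q <= (n.+1%:R^-1)%:E)%E &
      forall s t, (I01 `\` Q) s -> (I01 `\` Q) t ->
       `|sg (th n s) (th n t) - sg' (th' n s) (th' n t)| <= n.+1%:R^-1].
    by have [_ [Q [mQ _ Qn QP]]] := box n; exists Q.
  by have [Q QP] := choice ex; exists Q.
have mQ n : measurable (Q n) /\ (leb (Q n) <= (n.+1%:R^-1)%:E)%E by have [] := QP n.
have [U [UU ooU]] := ultraFilterLemma eventually_filter.
pose G n := I01 `\` Q n.
have iso : almost_isometric sg sg' th th' G U.
  move=> d d0; apply: filterS (ooU _ (near_natSinv_le d0)) => n /= nd s t Gs Gt.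
  by have [_ _ h] := QP n; apply: le_trans nd; exact: h.
have fl := full_support_approximable sgL UU ooU real mQ full.
have fl' := full_support_approximable sgL' UU ooU real' mQ full'.
have sh p : exists p', shadow sg sg' th th' G U p p'.
  exact: (shadow_exists iso fl sgL' bd').
have sh' p' : exists p, shadow sg' sg th' th G U p' p.
  exact: (shadow_exists (almost_isometric_sym iso _) fl' sgL bd).
have [iota iotaP] := choice sh.
have tauE p p' r r' : shadow sg sg' th th' G U p p' ->
    shadow sg sg' th th' G U r r' -> sg p r = sg' p' r' by exact: shadow_tau.
(* Every [z'] is a shadow of some [z], so distinguishing by [z'] amounts to distinguishing by [z];
   in particular [iota] is continuous. *)
have iota_close e x y : tclose sg e x y -> tclose sg' e (iota x) (iota y).
  move=> xy z'; have [z z'z] := sh' z'.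
  have zz' : shadow sg sg' th th' G U z z' by exact: shadow_sym.
  rewrite -(tauE _ _ _ _ (iotaP x) zz') -(tauE _ _ _ _ (iotaP y) zz').
  by rewrite -(tauE _ _ _ _ zz' (iotaP x)) -(tauE _ _ _ _ zz' (iotaP y)).
have iotaE x y : sg x y = sg' (iota x) (iota y) by exact: tauE.
have biota B : borel sg' B -> borel sg (iota @^-1` B).
  apply: (borel_ind sgL' (P := fun B => borel sg (iota @^-1` B))) => [V oV|A|A bA].
  - apply: (borel_open sgL) => x /oV[e e0 eV].
    by exists e => // y /iota_close/eV.
  - exact: borelC.
  - by rewrite preimage_bigcup; exact: borel_bigcup.
(* Testing against a finite d/3-net suffices, and finitely many members of [U] may be intersected.
   Each net point is the shadow of some [p], whose shadow estimate applies to [th n t]. *)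
have near d : 0 < d -> U [set n | forall t, G n t ->
    tclose sg' d (iota (th n t)) (th' n t)].
  move=> d0; have d30 : 0 < d / 3 by lra.
  have [s sP] := totally_bounded sgL' d30.
  have : U [set n | forall p', p' \in s -> forall t, G n t ->
      `|sg' p' (iota (th n t)) - sg' p' (th' n t)| <= d / 3 /\
      `|sg' (iota (th n t)) p' - sg' (th' n t) p'| <= d / 3].
    elim: s {sP} => [|p' s IHs]; first by apply: filterS filterT.
    have [p p'p] := sh' p'; have pp' : shadow sg sg' th th' G U p p' by exact: shadow_sym.
    apply: filterS (filterI IHs (pp' _ d30)) => n [ns np] z.
    rewrite in_cons => /orP[/eqP-> t Gt|/ns//].
    by rewrite -(tauE _ _ _ _ pp' (iotaP _)) -(tauE _ _ _ _ (iotaP _) pp'); exact: np.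
  apply: filterS => n ns t Gt z; have [p' p's p'z] := sP z.
  have [a1 a2] := ns p' p's t Gt.
  have [b1 b2] := p'z (iota (th n t)); have [c1 c2] := p'z (th' n t).
  move: a1 a2 b1 b2 c1 c2; rewrite !ler_distl.
  move=> /andP[? ?] /andP[? ?] /andP[? ?] /andP[? ?] /andP[? ?] /andP[? ?].
  by split; apply/andP; split; lra.
exists iota; split => // B bB.
have [i' _] := bd'.
pose PY : pointedType := HB.pack (Choice.sort Y') (isPointed.Build (Choice.sort Y') i').
have [m0 l0] := real 0%N; have [m0' l0'] := real' 0%N.
rewrite -l0; last exact: biota.
rewrite -l0'//.
apply: (@closed_domination_law R PY sg' sgL' (fun s => iota (th 0%N s)) (th' 0%N)) => //.
- by move=> A bA; apply: (m0 (iota @^-1` A)); exact: biota.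
- move=> F cF k.
  have bF : borel sg' F by exact: (borel_closed sgL').
  have bE : borel sg' (enlarge sg' F k.+1%:R^-1).
    by apply: (borel_closed sgL'); exact: enlarge_closed.
  have k0 : 0 < k.+1%:R^-1 :> R by [].
  have [n [nk kn]] := filter_ex (filterI (near _ k0) (ooU _ (near_natSinv_le k0))).
  have [mn ln] := real n; have [mn' ln'] := real' n; have [mQn Qn] := mQ n.
  (* All [th n] have the law [mu], so the index 0 may be replaced by the large [n], for which [iota]
     of [th n] is close to [th' n] off [Q n]. *)
  have -> : leb (I01 `&` (fun s => iota (th 0%N s)) @^-1` F) =
      leb (I01 `&` (fun s => iota (th n s)) @^-1` F).
    by rewrite (l0 (iota @^-1` F)) ?(ln (iota @^-1` F))//; exact: biota.
  rewrite l0'// -ln'//.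
  apply: (@le_trans _ _ (leb (I01 `&` th' n @^-1` enlarge sg' F k.+1%:R^-1) + leb (Q n))%E).
    apply: le_trans (measureU2 leb (mn' _ bE) mQn).
    apply: le_measure; rewrite ?inE.
    + by apply: (mn (iota @^-1` F)); exact: biota.
    + by apply: measurableU => //; exact: mn'.
    + move=> t [It Ft]; have [Qt|nQt] := pselect (Q n t); [by right|left].
      split=> // d dpos; exists (iota (th n t)) => //.
      by apply: tclose_le (nk t (conj It nQt)); rewrite lerDl ltW.
  by rewrite leeD2l//; apply: le_trans Qn _; rewrite lee_fin.
Qed.

End reconstruction.

(** * Isomorphy as vanishing of the box distance *)

Section isomorphic_box.
Context {R : realType}.
Local Notation RM := (measurableTypeR R).
Local Notation leb := (@lebesgue_measure R).
Local Notation I01 := (`[0%R, 1%R]%classic : set RM).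
Implicit Types X Y Z : nblmms R.

(** Transfers parametrizations of X to its quotient. Almost every value of [psi] lies in the
    support, where [Th] preserves [tau], so the pull-backs agree off a null set. *)
Lemma spt_realization X : exists Th : X -> spt_i0 X,
  full_support (@ext_tau _ _ (spt_i0 X)) (@spt_i0_push R X) /\
  forall psi, parametrization (X := X) psi ->
    realizes (@ext_tau _ _ (spt_i0 X)) (@spt_i0_push R X) (Th \o psi) /\
    forall d, 0 < d -> box_close (pull (X := X) psi)
      (fun s t => ext_tau (Th (psi s)) (Th (psi t))) d.
Proof.
have tauL := mm_lorentzian X.
have [Th [tauE cl cover bTh pushE]] := spt_projection X.
exists Th; split=> [y|psi [mpsi lpsi]].
  have [|[x sx ->]] := cover y; [by left|right=> e e0].
  have bb : borel (@ext_tau _ _ (spt_i0 X)) (tclose (@ext_tau _ _ (spt_i0 X)) e (Th x)).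
    by apply: (borel_closed (spt_i0_lorentzian X)); exact: tclose_ball_closed.
  pose U : set (g_sigma_algebraType (coarse_open (@mm_tau R X))) :=
    [set y | exists2 d, 0 < d & tclose (@mm_tau R X) d y `<=` tclose (@mm_tau R X) e x].
  have oU : coarse_open (@mm_tau R X) U.
    by rewrite (coarse_open_close tauL); exact: tclose_interior_open.
  have mU : (0 < mm_measure X U)%E by apply: sx => //; exists e.
  pose B : set (g_sigma_algebraType (coarse_open (@mm_tau R X))) :=
    Th @^-1` tclose (@ext_tau _ _ (spt_i0 X)) e (Th x).
  have mB : measurable B by exact: bTh.
  rewrite pushE//; apply: lt_le_trans mU _; rewrite -/B.
  rewrite -[leRHS]adde0 -(spt_null X).
  apply: (le_trans _ (measureU2 (mm_measure X) mB (measurableC (@measurable_spt R X)))).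
  apply: le_measure; rewrite ?inE.
  - exact: sub_sigma_algebra.
  - apply: (@measurableU _ (g_sigma_algebraType (coarse_open (@mm_tau R X)))) => //.
    exact: (measurableC (@measurable_spt R X)).
  - move=> z [d d0 dz]; have [sz|nsz] := pselect (spt z); [left|by right].
    by apply: cl => //; [exact: ltW|apply/dz/tclosexx/ltW].
split.
  split=> B bB; first by apply: (mpsi _ (Th @^-1` B)) => //; exact: bTh.
  by rewrite pushE// -lpsi//; exact: bTh.
move=> d d0; pose N := I01 `&` psi @^-1` (~` @spt R X).
have mN : measurable N by apply: mpsi => //; exact: (measurableC (@measurable_spt R X)).
have Nd : (leb N <= d%:E)%E.
  rewrite /N lpsi; last exact: (measurableC (@measurable_spt R X)).
  by rewrite spt_null lee_fin ltW.
split=> //; exists N; split=> //; first exact: subIsetl.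
move=> s t [s01 /not_andP[//|/contrapT sN]] [t01 /not_andP[//|/contrapT tN]].
by rewrite /pull tauE// subrr normr0 ltW.
Qed.

(** Composing a realization of the quotient of X with [iota] gives the law of the quotient of Y, so
    it can be matched with a realization of the latter. The thirds pay for this matching and for the
    two passages to quotients. *)
Lemma isomorphic_lorentz_box X Y : isomorphic X Y -> lorentz_box X Y = 0.
Proof.
move=> [iota [biota iotaE iotamu]]; apply/eqP.
rewrite eq_le lorentz_box_ge0 andbT; apply/ler_addgt0Pr => e e0; rewrite add0r.
have e30 : 0 < e / 3 by lra.
have [Th [_ ThP]] := spt_realization X; have [Th' [_ Th'P]] := spt_realization Y.
have [psi Ppsi] := parametrization_exists X.
have [psi' Ppsi'] := parametrization_exists Y.
have [[mTh lTh] bTh] := ThP _ Ppsi; have [[mTh' lTh'] bTh'] := Th'P _ Ppsi'.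
have [|||a [a' [aP a'P h]]] := lorentzian_matching (spt_i0_lorentzian Y)
  (phi := iota \o (Th \o psi)) (phi' := Th' \o psi') e30.
- by move=> B bB; apply: (mTh (iota @^-1` B)); exact: biota.
- exact: mTh'.
- move=> B bB; rewrite lTh'// -iotamu// -lTh//; exact: biota.
have h1 := box_close_comp aP (bTh _ e30).
have h3 := box_close_sym (box_close_comp a'P (bTh' _ e30)).
have h2 : box_close (fun s t => ext_tau (Th (psi (a s))) (Th (psi (a t))))
    (fun s t => ext_tau (Th' (psi' (a' s))) (Th' (psi' (a' t)))) (e / 3).
  by under eq_fun do under eq_fun do rewrite iotaE.
have := lorentz_box_le (parametrization_comp Ppsi aP) (parametrization_comp Ppsi' a'P)
  (box_close_trans h1 (box_close_trans h2 h3)).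
lra.
Qed.

Lemma lorentz_box0_isomorphic X Y : lorentz_box X Y = 0 -> isomorphic X Y.
Proof.
move=> XY0.
have [Th [full ThP]] := spt_realization X; have [Th' [full' Th'P]] := spt_realization Y.
have ex n : exists psis : (RM -> X) * (RM -> Y),
  [/\ parametrization (X := X) psis.1, parametrization (X := Y) psis.2 &
     (* The other two thirds of 1/(n+1) are spent on passing to the two quotients. *)
     box_close (pull (X := X) psis.1) (pull (X := Y) psis.2) (n.+1%:R^-1 / 3)].
  have n0 : 0 < n.+1%:R^-1 / 3 :> R by rewrite divr_gt0.
  have /lorentz_box_lt[psi [psi' [P P' h]]] : lorentz_box X Y < n.+1%:R^-1 / 3.
    by rewrite XY0.
  by exists (psi, psi').
have [psis psisP] := choice ex.
apply: (reconstruction (th := fun n => Th \o (psis n).1) (th' := fun n => Th' \o (psis n).2)).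
- exact: spt_i0_lorentzian.
- exact: spt_i0_lorentzian.
- exact: spt_i0_boundary.
- exact: spt_i0_boundary.
- exact: full.
- exact: full'.
- by move=> n; have [P _ _] := psisP n; have [] := ThP _ P.
- by move=> n; have [_ P _] := psisP n; have [] := Th'P _ P.
- move=> n; have [P P' h] := psisP n.
  have n0 : 0 < n.+1%:R^-1 / 3 :> R by rewrite divr_gt0.
  have [_ /(_ _ n0) h1] := ThP _ P; have [_ /(_ _ n0) h2] := Th'P _ P'.
  have := box_close_trans (box_close_sym h1) (box_close_trans h h2).
  by rewrite (_ : _ + _ = n.+1%:R^-1)//; set x := _^-1; lra.
Qed.

Lemma isomorphicP X Y : isomorphic X Y <-> lorentz_box X Y = 0.
Proof. by split; [exact: isomorphic_lorentz_box|exact: lorentz_box0_isomorphic]. Qed.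

Lemma lorentz_box_xx X : lorentz_box X X = 0.
Proof.
by apply/isomorphicP; exists id.
Qed.

Lemma lorentz_box_congr X X' Y Y' : isomorphic X X' -> isomorphic Y Y' ->
  lorentz_box X Y = lorentz_box X' Y'.
Proof.
have le Z Z' W W' : isomorphic Z Z' -> isomorphic W W' ->
    lorentz_box Z W <= lorentz_box Z' W'.
  move=> /isomorphicP ZZ' /isomorphicP WW'.
  have := lorentz_box_triangle Z' Z W; have := lorentz_box_triangle W' Z' W.
  by rewrite ZZ' (lorentz_box_sym W') WW'; lra.
have sym Z W : isomorphic Z W -> isomorphic W Z.
  by move=> /isomorphicP ZW; apply/isomorphicP; rewrite lorentz_box_sym.
by move=> XX' YY'; apply/eqP; rewrite eq_le !le//; exact: sym.
Qed.

Lemma iso_class_eq X Y : iso_class X = iso_class Y <-> isomorphic X Y.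
Proof.
split=> [[XY]|XY].
  by rewrite XY; apply/isomorphicP; exact: lorentz_box_xx.
have -> // : isomorphic X = isomorphic Y -> iso_class X = iso_class Y.
  by move=> e; apply: eq_exist.
(* Classes are predicates, hence equal by extensionality; symmetry and transitivity of isomorphy
   come from the box distance. *)
apply/funext => Z; apply/propext.
by rewrite !isomorphicP (lorentz_box_congr XY (_ : isomorphic Z Z))//;
  apply/isomorphicP; exact: lorentz_box_xx.
Qed.

End isomorphic_box.

(** * The metric on isomorphism classes *)

Theorem theorem4p18 (R : realType) :
  exists d : iso_classes R -> iso_classes R -> R,
    (forall X X' : nblmms R,
      d (iso_class X) (iso_class X') = lorentz_box X X') /\
    is_metric d.
Proof.
have repP (C : iso_classes R) : exists X, C = iso_class X.
  by case: C => C [X CX]; exists X; exact: eq_exist.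
(* The distance of two classes is that of chosen representatives; invariance under isomorphy shows
   independence of the choice. *)
have [rep repE] := choice repP.
have dE X Y : lorentz_box (rep (iso_class X)) (rep (iso_class Y)) = lorentz_box X Y.
  by apply: lorentz_box_congr; apply/iso_class_eq; rewrite -repE.
exists (fun C C' => lorentz_box (rep C) (rep C')); split=> //; split.
- by move=> C C'; exact: lorentz_box_ge0.
- move=> C C'; rewrite -isomorphicP -iso_class_eq -!repE; split=> // ->.
- by move=> C C'; exact: lorentz_box_sym.
- by move=> C C' C''; exact: lorentz_box_triangle.
Qed.
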